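(* If there is a probability measure $\mathfrak m$ on $D$ such that $\mu(w,dz)=\mathfrak m(dz)$ for all $w\in D^c$, then the stationary density $\kappa$ of the semigroup $K$ equals $c\,\mathfrak m g_D$, i.e. $\kappa(y)=c\int_D g_D(x,y)\,\mathfrak m(dx)$ for (almost every) $y\in D$, where $c$ is the normalizing constant (chosen so that $\int_D\kappa(y)\,dy=1$).
   Context: Setting. Let $d\in\mathbb N$, $\alpha\in(0,2)$, and let $D\subset\mathbb R^d$ be a nonempty bounded open Lipschitz set; $D^c=\mathbb R^d\setminus D$. All sets, functions, measures and kernels are Borel. $Y=(Y_t)_{t\ge0}$ is the isotropic $\alpha$-stable Lévy process in $\mathbb R^d$ (characteristic function $e^{-t|\xi|^\alpha}$), with Lévy kernel density $\nu(x,z)=c_{d,\alpha}|x-z|^{-d-\alpha}$, $c_{d,\alpha}=\frac{2^\alpha\Gamma((d+\alpha)/2)}{\pi^{d/2}|\Gamma(-\alpha/2)|}$; $\mathbf P^x$ is its law started at $x$. $\tau_D=\inf\{t>0:Y_t\notin D\}$. $p_D(t,x,y)$ ($t>0$, $x,y\in D$) is the Dirichlet heat kernel of $D$, i.e. the jointly continuous density with $\mathbf P^x(Y_t\in A,\,t<\tau_D)=\int_A p_D(t,x,y)\,dy$ for $A\subset D$. The Green function is $g_D(x,y)=\int_0^\infty p_D(s,x,y)\,ds$. Reflection kernel. $\mu$ is a Markov kernel from $D^c$ to $D$: $z\mapsto\mu(z,A)$ is Borel on $D^c$ for every Borel $A\subset D$, and $\mu(z,\cdot)$ is a probability measure on $D$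 for every $z\in D^c$. Moreover there is a compact $H\subset D$ with $\inf_{z\in D^c}\mu(z,H)>0$ (automatic when $\mu(z,\cdot)$ does not depend on $z$). Put $\nu\mathbf 1_{D^c}\mu(v,B)=\int_{D^c}\nu(v,z)\mu(z,B)\,dz$ for $v\in D$, $B\subset D$. Semigroup $K$. Let $k_0=p_D$ and, for $n=0,1,2,\dots$, $k_{n+1}(t,x,y)=\int_0^t ds\int_D dv\int_D p_D(s,x,v)\,\nu\mathbf 1_{D^c}\mu(v,dw)\,k_n(t-s,w,y)$; $k=\sum_{n\ge0}k_n$; $K(t)f(x)=\int_D k(t,x,y)f(y)\,dy$. It is known that $K=(K(t))_{t>0}$ is a Markovian semigroup with a unique stationary distribution, i.e. a unique probability measure $\kappa$ on $D$ with $\int K(t)f\,d\kappa=\int f\,d\kappa$ for all bounded $f$ and $t>0$, and that it has a density, also denoted $\kappa$. *)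

(* Defs.v *)
From HB Require Import structures.
From mathcomp Require Import all_boot all_order all_algebra.
From mathcomp Require Import all_classical all_reals all_analysis.
From mathcomp Require Import measurable_realfun.

Set Implicit Arguments.
Unset Strict Implicit.
Unset Printing Implicit Defensive.

Import Order.TTheory GRing.Theory Num.Theory.
Import numFieldNormedType.Exports.

Local Open Scope classical_set_scope.
Local Open Scope ring_scope.

(* R^n is 'rV[R]_n.  Its measurable sets form the sigma-algebra generated by the
   coordinate maps, that is, the Borel sigma-algebra of R^n. *)

Definition rV_display : measure_display -> measure_display.
Proof. exact. Qed.

Section measurable_rV.
Context {disp : measure_display} {T : sigmaRingType disp}.
Variable n : nat.

Let coors : 'I_n -> 'rV[T]_n -> T := fun i x => x ord0 i.

Let rV_set0 : g_sigma_preimage coors set0.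
Proof. exact: sigma_algebra0. Qed.

Let rV_setC A : g_sigma_preimage coors A -> g_sigma_preimage coors (~` A).
Proof. exact: sigma_algebraC. Qed.

Let rV_bigcup (F : _^nat) : (forall i, g_sigma_preimage coors (F i)) ->
  g_sigma_preimage coors (\bigcup_i (F i)).
Proof. exact: sigma_algebra_bigcup. Qed.

HB.instance Definition _ := @isMeasurable.Build (rV_display disp)
  'rV[T]_n (g_sigma_preimage coors) rV_set0 rV_setC rV_bigcup.

End measurable_rV.

Section measurable_rV_theory.
Context {d1 d2 : measure_display} {T1 : measurableType d1}
  {T2 : measurableType d2}.

Lemma measurable_coord n (i : 'I_n) :
  measurable_fun [set: 'rV[T2]_n] (fun x => x ord0 i).
Proof.
move=> _ Y mY; rewrite setTI; apply: sub_sigma_algebra => /=.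
rewrite -bigcup_seq/=; exists i => /=; first by rewrite mem_index_enum.
by exists Y => //; rewrite setTI.
Qed.

Lemma measurable_fun_rV n (f : T1 -> 'rV[T2]_n) :
  (forall i, measurable_fun [set: T1] (fun x => f x ord0 i)) ->
  measurable_fun [set: T1] f.
Proof.
move=> mf; suff H : g_sigma_preimage
    (fun i => (fun x : 'rV[T2]_n => x ord0 i) \o f) `<=` measurable.
  move=> _ A mA; apply: H; rewrite g_sigma_preimage_comp.
  by exists A.
apply: smallest_sub; first exact: sigma_algebra_measurable.
case: n => [|n] in f mf *; first by rewrite big_ord0.
rewrite -bigcup_mkord_ord; apply: bigcup_sub => i Ii.
by move=> A [B mB <-]; exact: mf.
Qed.

End measurable_rV_theory.

Section lebesgue_rV_construction.
Context {R : realType}.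

Definition row_cons n (p : R * 'rV[R]_n) : 'rV[R]_n.+1 :=
  row_mx (p.1%:M : 'rV_1) p.2.

Definition row_uncons n (x : 'rV[R]_n.+1) : R * 'rV[R]_n :=
  (x ord0 ord0, rsubmx (x : 'rV_(1 + n))).

Lemma row_consK n : cancel (@row_cons n) (@row_uncons n).
Proof.
move=> [a y]; rewrite /row_uncons /row_cons /= row_mxKr; congr pair.
rewrite (_ : (ord0 : 'I_n.+1) = lshift n (ord0 : 'I_1)); last exact/val_inj.
by rewrite (row_mxEl (a%:M : 'rV_1) y) !mxE eqxx mulr1n.
Qed.

Lemma measurable_row_cons n : measurable_fun [set: R * 'rV[R]_n] (@row_cons n).
Proof.
apply: measurable_fun_rV => i.
rewrite /row_cons.
case: (@split_ordP 1 n i) => j ->.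
- rewrite (_ : (fun x => _) = fst)// funeqE => -[a y] /=.
  by rewrite (row_mxEl (a%:M : 'rV_1) y) !mxE (ord1 j) eqxx mulr1n.
- rewrite (_ : (fun x => _) = (fun y : 'rV[R]_n => y ord0 j) \o snd).
    by apply: measurableT_comp; [exact: measurable_coord|exact: measurable_snd].
  by rewrite funeqE => -[a y] /=; rewrite (row_mxEr (a%:M : 'rV_1) y).
Qed.

Lemma measurable_row_uncons n :
  measurable_fun [set: 'rV[R]_n.+1] (@row_uncons n).
Proof.
apply/measurable_fun_pairP; split; first exact: measurable_coord.
apply: measurable_fun_rV => i.
rewrite (_ : (fun x => _) = fun x : 'rV[R]_n.+1 => x ord0 (rshift 1 i)).
  exact: measurable_coord.
by rewrite funeqE => x /=; rewrite mxE.
Qed.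

Section step.
Variables (n : nat) (m : {sigma_finite_measure set 'rV[R]_n -> \bar R}).

Definition leb_succ : set 'rV[R]_n.+1 -> \bar R :=
  pushforward (@lebesgue_measure R \x m)%E (@row_cons n).

Let leb_succ0 : leb_succ set0 = 0%E.
Proof. by rewrite /leb_succ /pushforward preimage_set0 measure0. Qed.

Let leb_succ_ge0 A : (0 <= leb_succ A)%E.
Proof. by rewrite /leb_succ /pushforward; exact: measure_ge0. Qed.

Let leb_succ_additive : semi_sigma_additive leb_succ.
Proof.
move=> F mF tF mUF; rewrite /leb_succ /pushforward preimage_bigcup.
apply: measure_semi_sigma_additive.
- by move=> k; rewrite -[X in measurable X]setTI; exact: measurable_row_cons.
- apply/trivIsetP => /= i j _ _ ij; rewrite -preimage_setI.
  by move/trivIsetP : tF => /(_ _ _ _ _ ij) ->//; rewrite preimage_set0.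
- by rewrite -preimage_bigcup -[X in measurable X]setTI;
    exact: measurable_row_cons.
Qed.

HB.instance Definition _ :=
  isMeasure.Build _ _ _ leb_succ leb_succ0 leb_succ_ge0 leb_succ_additive.

Let leb_succ_sigma_finite : sigma_finite setT leb_succ.
Proof.
have /sigma_finiteP[F [TF ndF Foo]] := sigma_finiteT (@lebesgue_measure R).
have /sigma_finiteP[G [TG ndG Goo]] := sigma_finiteT m.
exists (fun k => @row_uncons n @^-1` (F k `*` G k)).
  rewrite predeqE => x; split=> // _.
  have [i _ Fi] : (\bigcup_k F k) (row_uncons x).1 by rewrite -TF.
  have [j _ Gj] : (\bigcup_k G k) (row_uncons x).2 by rewrite -TG.
  exists (maxn i j) => //; split.
  - by move: Fi; exact/subsetPset/ndF/leq_maxl.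
  - by move: Gj; exact/subsetPset/ndG/leq_maxr.
move=> k; have [mF Fk] := Foo k; have [mG Gk] := Goo k; split.
  rewrite -[X in measurable X]setTI; apply: measurable_row_uncons => //.
  exact: measurableX.
rewrite /leb_succ /pushforward -comp_preimage.
rewrite (_ : _ \o _ = id); last by rewrite funeqE => x /=; rewrite row_consK.
by rewrite preimage_id product_measure1E// lte_mul_pinfty// ge0_fin_numE.
Qed.

HB.instance Definition _ :=
  Measure_isSigmaFinite.Build _ _ _ leb_succ
    leb_succ_sigma_finite.

End step.

Fixpoint lebesgue_rV (n : nat) : {sigma_finite_measure set 'rV[R]_n -> \bar R} :=
  match n with
  | 0 => \d_(0 : 'rV[R]_0)
  | n'.+1 => leb_succ (lebesgue_rV n')
  end.

End lebesgue_rV_construction.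

Section euclidean.
Context {R : realType} {n : nat}.
Implicit Types x y : 'rV[R]_n.

(* The library norm of 'rV[R]_n is the sup norm (with the same topology), whence
   the Euclidean norm here. *)
Definition dotp x y : R := \sum_(i < n) x ord0 i * y ord0 i.
Definition enorm x : R := Num.sqrt (dotp x x).

(* Open Lipschitz sets: near each boundary point Q, D is the part above the
   graph of a Lipschitz function.  The unit vector e is the vertical direction of
   a rotated coordinate system centred at Q, the hyperplane orthogonal to e is
   its horizontal hyperplane, and phi is evaluated on that hyperplane only. *)
Definition lipschitz_set (D : set 'rV[R]_n) : Prop :=
  open D /\
  forall Q, (closure D `\` D) Q ->
  exists (r L : R) (e : 'rV[R]_n) (phi : 'rV[R]_n -> R),
  [/\ 0 < r, dotp e e = 1,
      forall x y, `|phi x - phi y| <= L * enorm (x - y) &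
      forall y, enorm (y - Q) < r ->
        let h := dotp (y - Q) e in D y <-> phi (y - Q - h *: e) < h].

Lemma measurable_enorm : measurable_fun [set: 'rV[R]_n] enorm.
Proof.
apply: measurableT_comp.
  exact: continuous_measurable_fun (@sqrt_continuous R).
by apply: measurable_sum => i; apply: measurable_funM; exact: measurable_coord.
Qed.

End euclidean.

Section stable.
Context {R : realType} {d : nat} {disp : measure_display}
  {Omega : measurableType disp} (P : probability Omega R).

(* The isotropic alpha-stable Levy process started at 0; it is indexed by R, but
   only nonnegative times matter.  The law P^x is that of x + Y under P.  The two
   expectations are the real and imaginary parts of E exp(i <xi, Y_t>). *)
Definition stable_process (alpha : R) (Y : R -> Omega -> 'rV[R]_d) : Prop :=
  [/\ forall t, 0 <= t -> measurable_fun setT (Y t),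
      {ae P, forall w, Y 0 w = 0},
      forall (n : nat) (t : nat -> R) (B : nat -> set 'rV[R]_d),
        0 <= t 0%N -> (forall i, t i <= t i.+1) ->
        (forall i, measurable (B i)) ->
        P (\bigcap_(i < n) [set w | B i (Y (t i.+1) w - Y (t i) w)]) =
        (\prod_(i < n) P [set w | B i (Y (t i.+1) w - Y (t i) w)%R])%E &
      [/\ forall (s t : R) (B : set 'rV[R]_d),
            0 <= s -> 0 <= t -> measurable B ->
            P [set w | B (Y (s + t) w - Y s w)] = P [set w | B (Y t w)],
          {ae P, forall w, forall t, 0 <= t ->
            Y s w @[s --> t^'+] --> Y t w /\
            (0 < t -> exists l : 'rV[R]_d, Y s w @[s --> t^'-] --> l)} &
          forall (t : R) (xi : 'rV[R]_d), 0 <= t ->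
            ('E_P[fun w => cos (dotp xi (Y t w))] =
               (expR (- t * enorm xi `^ alpha)%R)%:E /\
             'E_P[fun w => sin (dotp xi (Y t w))] = 0)%E]].

(* P(E) = r in the completion of P.  Exit-time events of a cadlag process
   need not belong to the sigma-algebra of Omega, only to its completion. *)
Definition completed_prob (E : set Omega) (r : \bar R) : Prop :=
  exists E1 E2, [/\ measurable E1, measurable E2, E1 `<=` E, E `<=` E2 &
                    P E1 = r /\ P E2 = r].

Definition exit_time (D : set 'rV[R]_d) (X : R -> Omega -> 'rV[R]_d)
    (w : Omega) : \bar R :=
  ereal_inf [set t%:E | t in [set t : R | 0 < t /\ ~ D (X t w)]].

Definition dirichlet_heat_kernel (Y : R -> Omega -> 'rV[R]_d)
    (D : set 'rV[R]_d) (p : R -> 'rV[R]_d -> 'rV[R]_d -> R) : Prop :=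
  [/\ forall t x y, 0 < t -> D x -> D y -> 0 <= p t x y,
      forall t x y, 0 < t -> D x -> D y ->
        {for (t, x, y), continuous
          (fun q : R * 'rV[R]_d * 'rV[R]_d => p q.1.1 q.1.2 q.2)} &
      forall (t : R) (x : 'rV[R]_d) (A : set 'rV[R]_d),
        0 < t -> D x -> measurable A -> A `<=` D ->
        completed_prob
          [set w | A (x + Y t w) /\
                   (t%:E < exit_time D (fun s w' => (x + Y s w')%R) w)%E]
          (\int[lebesgue_rV d]_(y in A) (p t x y)%:E)%E].

End stable.

Section jump_kernel.
Context {R : realType}.

Definition euler_integral (z : R) : R :=
  \int[lebesgue_measure]_(t in `]0, +oo[%classic) (t `^ (z - 1) * expR (- t)).

(* Euler's Gamma function on ]-1, 0[ and ]0, +oo[ (elsewhere, a junk value). *)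
Definition Gamma (z : R) : R :=
  if 0 < z then euler_integral z else euler_integral (z + 1) / z.

Definition stable_const (d : nat) (alpha : R) : R :=
  2 `^ alpha * Gamma ((d%:R + alpha) / 2) /
  (pi `^ (d%:R / 2) * `|Gamma (- (alpha / 2))|).

Definition nu {d : nat} (alpha : R) (x z : 'rV[R]_d) : R :=
  stable_const d alpha * enorm (x - z) `^ (- d%:R - alpha).

End jump_kernel.

Section reflection.
Context {R : realType} {d : nat}.
Notation Rd := 'rV[R]_d.
Variables (D : set Rd) (mu : Rd -> probability Rd R).

(* mu is a Markov kernel from the complement of D to D; the measures mu z for
   z in D play no role.  It satisfies the concentration condition below. *)
Definition reflection_kernel : Prop :=
  [/\ forall A : set Rd, measurable A -> A `<=` D ->
        measurable_fun (~` D) (fun z => mu z A),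
      forall z, ~ D z -> mu z D = 1%E &
      exists H : set Rd, [/\ compact H, H `<=` D &
        (0 < ereal_inf [set mu z H | z in ~` D])%E]].

Variable alpha : R.

(* nu 1_{D^c} mu (v, .) *)
Definition nu_mu (v : Rd) (B : set Rd) : \bar R :=
  (\int[lebesgue_rV d]_(z in ~` D) ((nu alpha v z)%:E * mu z B))%E.

(* nu_mu is integrated against below as a plain set function; it is a measure. *)
Lemma nu_mu_sigma_additive (v : Rd) :
  0 < alpha -> measurable D -> reflection_kernel ->
  [/\ nu_mu v set0 = 0%E, forall B, (0 <= nu_mu v B)%E &
      semi_sigma_additive (nu_mu v)].
Proof.
move=> alpha0 mD [mmu muD _]; have mDc := measurableC mD.
have nu0 z : (0 <= (nu alpha v z)%:E)%E.
  have a0 : 0 < (d%:R + alpha) / 2 by rewrite divr_gt0// ltr_wpDl.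
  rewrite lee_fin /nu mulr_ge0 ?powR_ge0// /stable_const divr_ge0//.
    rewrite mulr_ge0 ?powR_ge0// /Gamma a0; apply: Rintegral_ge0 => t _.
    by rewrite mulr_ge0 ?powR_ge0 ?expR_ge0.
  by rewrite mulr_ge0 ?powR_ge0.
have mnu : measurable_fun (~` D) (fun z => (nu alpha v z)%:E).
  apply/measurable_EFinP; apply: measurable_funM; first exact: measurable_cst.
  apply: measurable_funTS.
  apply: (measurableT_comp (measurable_powR (- d%:R - alpha))).
  apply: (measurableT_comp measurable_enorm).
  apply: measurable_fun_rV => i.
  rewrite (_ : (fun x => _) = fun x : Rd => v ord0 i - x ord0 i).
    by apply: measurable_funB; [exact: measurable_cst|exact: measurable_coord].
  by rewrite funeqE => x; rewrite !mxE.
have mmuB B : measurable B -> measurable_fun (~` D) (fun z => mu z B).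
  move=> mB; apply: (eq_measurable_fun (fun z => mu z (B `&` D))); last first.
    by apply: mmu; [exact: measurableI|exact: subIsetr].
  move=> z /set_mem /= zD.
  have h : mu z (B `\` D) = 0%E.
    apply/eqP; rewrite eq_le measure_ge0 andbT.
    have -> : 0%E = mu z (~` D) by rewrite probability_setC// muD// subee.
    apply: le_measure; [|by rewrite inE|by move=> ? []].
    by rewrite inE; exact: measurableD.
  have e : mu z B = (mu z (B `\` D) + mu z (B `&` D))%E by exact: measureDI.
  by rewrite h add0e in e.
split.
- by apply: integral0_eq => z _; rewrite measure0 mule0.
- by move=> B; apply: integral_ge0 => z _; rewrite mule_ge0.
- move=> F mF tF mUF.
  rewrite [X in _ --> X](_ : _ = (\sum_(k <oo) nu_mu v (F k))%E).
    apply/cvg_closeP; split; last by rewrite closeE.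
    by apply: is_cvg_nneseries => k _ _; apply: integral_ge0 => z _; rewrite mule_ge0.
  rewrite -integral_nneseries//.
  + apply: eq_integral => z _; rewrite nneseriesZl//.
    congr mule; apply/esym/cvg_lim => //; exact: measure_semi_sigma_additive.
  + by move=> k; apply: emeasurable_funM => //; exact: mmuB.
  + by move=> k z _; rewrite mule_ge0.
Qed.

Variable p : R -> Rd -> Rd -> R.

Fixpoint kn (n : nat) (t : R) (x y : Rd) : \bar R :=
  match n with
  | 0 => (p t x y)%:E
  | n'.+1 => (\int[lebesgue_measure]_(s in `]0%R, t[%classic)
               \int[lebesgue_rV d]_(v in D) \int[nu_mu v]_(w in D)
                 ((p s x v)%:E * kn n' (t - s)%R w y))%E
  end.

Definition kk (t : R) (x y : Rd) : \bar R := (\sum_(n <oo) kn n t x y)%E.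

Definition KK (t : R) (f : Rd -> R) (x : Rd) : \bar R :=
  (\int[lebesgue_rV d]_(y in D) (kk t x y * (f y)%:E))%E.

Definition green (x y : Rd) : \bar R :=
  (\int[lebesgue_measure]_(s in `]0%R, +oo[%classic) (p s x y)%:E)%E.

Definition stationary (pi0 : probability Rd R) : Prop :=
  pi0 D = 1%E /\
  forall (f : Rd -> R) (t : R),
    measurable_fun D f -> (exists M, forall x, D x -> `|f x| <= M) -> 0 < t ->
    (\int[pi0]_(x in D) KK t f x = \int[pi0]_(x in D) (f x)%:E)%E.

Definition density (kappa : Rd -> R) (pi0 : probability Rd R) : Prop :=
  [/\ measurable_fun D kappa, forall y, D y -> 0 <= kappa y &
      forall A : set Rd, measurable A -> A `<=` D ->
        pi0 A = (\int[lebesgue_rV d]_(y in A) (kappa y)%:E)%E].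

End reflection.

(* Main.v *)
Require Import Defs.
From HB Require Import structures.
From mathcomp Require Import all_boot all_order all_algebra.
From mathcomp Require Import all_classical all_reals all_analysis.
From mathcomp Require Import measurable_realfun.
From mathcomp Require Import ring lra.

Import Order.TTheory GRing.Theory Num.Theory.
Import numFieldNormedType.Exports.

Local Open Scope classical_set_scope.
Local Open Scope ring_scope.

(** Since every reflection restarts from the same law m, the restarted
    evolution is a renewal process.  Write q for the Dirichlet heat kernel
    [p] extended by zero, phi(s,x) = int_D q(s,x,v) k(v) dv with k the killing
    rate v |-> int_(D^c) nu(v,z) dz, and, for a probability m', let m'phi and
    m'q be the averages of phi and q over the starting point.  Because
    [nu_mu v] is k(v) times m, the (n+1)-st term of the series of [kk] is the
    convolution in time of phi(.,x) with u_n, where u_0 = mq and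
    u_(n+1) = mphi * u_n ([kn_kernel_term]).  Integrating over the stationary
    law pi, and over y in A, gives for all t > 0
<<
      pi(A) = pi q_t (A) + sum_n (pi phi * u_n(A)) (t)
>>
    ([stationary_renewal]).  The Laplace transform turns convolutions into
    products, so that with G_l(m', A) the resolvent mass
    int_0^oo exp(-l t) m' q_t(A) dt one gets, for l > 0 and A included in D,
<<
      pi(A) / l = G_l(pi, A) + w(l) G_l(m, A)
>>
    with a weight w(l) in [0, +oo] that does not depend on A
    ([laplace_stationary]).  Comparing A with D eliminates w, even if it is
    infinite, and leaves
<<
      G_l(m, A) (1 - l G_l(pi, D)) = (pi(A) - l G_l(pi, A)) G_l(m, D)
>>
    ([stationary_green_mass_real]).  Resolvent masses stay bounded as l tends
    to 0, because the survival probability decays exponentially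
    ([survival_le_expR]): in each time span of length s a path
    that stays in D makes an increment bounded in terms of D, and for a
    suitable s this has probability less than 1, since the characteristic
    function of Y_s at a fixed frequency tends to 0 as s grows
    ([leaves_slab]).  The limit is
    G_0(m, A) = pi(A) G_0(m, D) ([stationary_green_mass]).  Moreover
    G_0(m, D) > 0, otherwise 1 / l = G_l(pi, D) would be bounded
    ([green_mass_gt0]).  As G_0(m, .) has density m g_D on D ([green_massE]),
    the densities of pi and of m g_D agree up to the factor 1 / G_0(m, D). *)

(** * Borel sets and open sets of time-space products *)

(** The members of the countable base need not be open; they only have to lie
    in [M], so that rational boxes can be used directly as measurable sets. *)
Definition countable_base_in {T : topologicalType} (M : set (set T)) : Prop :=
  exists (I : countType) (B : I -> set T),
    (forall i, M (B i)) /\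
    forall x U, nbhs x U -> exists2 i, B i x & B i `<=` U.

Lemma countable_base_in_R (R : realType) :
  @countable_base_in R (@measurable _ R).
Proof.
exists (rat * rat)%type, (fun q => `]ratr q.1, ratr q.2[%classic); split.
  by move=> q; exact: measurable_itv.
move=> x U /nbhs_ballP[e /= e0 eU].
have [q1 q1P] := @rat_in_itvoo R (x - e) x ltac:(by rewrite ltrBlDr ltrDl).
have [q2 q2P] := @rat_in_itvoo R x (x + e) ltac:(by rewrite ltrDl).
move: q1P q2P; rewrite !in_itv /= => /andP[a1 a2] /andP[b1 b2].
exists (q1, q2); first by rewrite /= in_itv /= a2 b1.
move=> y /=; rewrite in_itv /= => /andP[c1 c2]; apply: eU.
rewrite /ball /= ltr_distlC (lt_trans a1 c1)/=.
exact: lt_trans c2 b2.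
Qed.

Lemma countable_base_in_prod (T1 T2 : topologicalType) (M1 : set (set T1))
  (M2 : set (set T2)) (M : set (set (T1 * T2))) :
  (forall A1 A2, M1 A1 -> M2 A2 -> M (A1 `*` A2)) ->
  countable_base_in M1 -> countable_base_in M2 -> countable_base_in M.
Proof.
move=> M12 [I1 [B1 [mB1 H1]]] [I2 [B2 [mB2 H2]]].
exists (I1 * I2)%type, (fun i => B1 i.1 `*` B2 i.2); split.
  by move=> [i1 i2] /=; exact: M12.
move=> [x1 x2] U [[/= U1 U2] [/= n1 n2] sU].
have [i1 h1 k1] := H1 _ _ n1; have [i2 h2 k2] := H2 _ _ n2.
exists (i1, i2) => //= -[y1 y2] /= [/k1 ? /k2 ?]; exact: sU.
Qed.

Lemma countable_base_in_rV (R : realType) n :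
  @countable_base_in 'rV[R]_n (@measurable _ 'rV[R]_n).
Proof.
have [I [B [mB HB]]] := countable_base_in_R R.
exists {ffun 'I_n -> I},
  (fun f : {ffun 'I_n -> I} => [set x : 'rV[R]_n | forall j, B (f j) (x ord0 j)]).
split.
  move=> f; rewrite (_ : [set _ | _] =
    \bigcap_(j in [set: 'I_n]) ((fun x : 'rV[R]_n => x ord0 j) @^-1` B (f j))).
    apply: fin_bigcap_measurable => // j _.
    by rewrite -[X in measurable X]setTI; exact: measurable_coord.
  by apply/seteqP; split => x /= H j; [move=> _|]; apply: H.
move=> x U [P nP PU].
have H j : exists i, B i (x ord0 j) /\ B i `<=` P ord0 j.
  by have [i ? ?] := HB _ _ (nP ord0 j); exists i.
have [f fP] := choice H.
exists [ffun j => f j]; first by move=> j; rewrite ffunE; have [] := fP j.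
move=> y /= By; apply: PU => i j; rewrite (ord1 i).
by have := By j; rewrite ffunE; have [_] := fP j; apply.
Qed.

(** An open set is the union of the countably many base sets it contains;
    this is what makes the sigma-algebra generated by the coordinates contain
    the open sets. *)
Lemma open_in_of_base (T : topologicalType) (M : set (set T)) (U : set T) :
  M set0 -> (forall F : nat -> set T, (forall i, M (F i)) -> M (\bigcup_i F i)) ->
  countable_base_in M -> open U -> M U.
Proof.
move=> M0 MU [I [B [MB HB]]] oU.
rewrite (_ : U = \bigcup_n (if unpickle n is Some i then
  if `[< B i `<=` U >] then B i else set0 else set0)).
  by apply: MU => n; case: unpickle => // i; case: ifP.
apply/seteqP; split => [x Ux|x [n _]].
  have /HB[i Bix BiU] : nbhs x U by exact: open_nbhs_nbhs.
  by exists (pickle i) => //; rewrite pickleK; case: asboolP.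
by case: unpickle => // i; case: asboolP => // H /H.
Qed.

Lemma open_measurable_rV (R : realType) n (U : set 'rV[R]_n) :
  open U -> measurable U.
Proof.
apply: open_in_of_base; last exact: countable_base_in_rV.
  exact: measurable0.
by move=> F mF; exact: bigcupT_measurable.
Qed.

Section continuous_on_open.
Context {R : realType} {n : nat}.
Notation Rd := 'rV[R]_n.

Lemma open_measurable_time_space2 (U : set (R * Rd * Rd)) :
  open U -> measurable U.
Proof.
apply: open_in_of_base; first exact: measurable0.
  by move=> F mF; exact: bigcupT_measurable.
apply: countable_base_in_prod (countable_base_in_rV R n).
  exact: (@measurableX _ _ (R * Rd)%type Rd).
apply: countable_base_in_prod (countable_base_in_R R) (countable_base_in_rV R n).
exact: measurableX.
Qed.

(** The heat kernel is only known to be continuous on the open set where time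
    is positive and both points are in [D]; its values elsewhere are
    arbitrary. *)
Lemma measurable_fun_continuous_on_open (U : set (R * Rd * Rd))
    (f : R * Rd * Rd -> R) :
  open U -> (forall q, U q -> {for q, continuous f}) ->
  measurable_fun U f.
Proof.
move=> oU cf; apply: (measurability _ (RGenOInfty.measurableE R)) => //.
move=> _ [_ [a ->] <-]; apply: open_measurable_time_space2.
rewrite openE => q [Uq /= fq]; apply: filterI.
  exact: open_nbhs_nbhs.
by apply: (cf q Uq); apply: open_nbhs_nbhs.
Qed.

End continuous_on_open.

(** * Convolution and Laplace transform on the time axis *)

Section convolution.
Local Open Scope ereal_scope.
Context {R : realType}.
Notation leb := (@lebesgue_measure R).

Lemma ge0_integral_translation (f : R -> \bar R) (s : R) :
  measurable_fun [set: R] f -> (forall t, 0 <= f t) ->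
  \int[leb]_t f (t - s)%R = \int[leb]_t f t.
Proof.
move=> mf f0.
have ms : measurable_fun [set: R] (fun t : R => (t - s)%R).
  by apply: measurable_funB; [exact: measurable_id|exact: measurable_cst].
transitivity (\int[pushforward leb (fun t : measurableTypeR R => (t - s)%R
    : measurableTypeR R)]_t f t).
  by rewrite ge0_integral_pushforward// preimage_setT.
apply: eq_measure_integral => A mA _; apply/esym.
apply: (@lebesgue_measure_unique R) => // _ [[a b] _ <-] /=.
rewrite /pushforward (_ : _ @^-1` _ = `](a + s)%R, (b + s)%R]%classic).
  rewrite !lebesgue_measure_itv/= !lte_fin ltrD2r; case: ifP => // _.
  by rewrite -!EFinB; congr EFin; rewrite opprD addrACA subrr addr0.
by apply/seteqP; split => t /=; rewrite !in_itv/= ltrBrDr lerBlDr.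
Qed.

(** The integral runs over the whole line: for functions vanishing on
    negative times it is the usual convolution over ]0, t[. *)
Definition conv (f g : R -> \bar R) (t : R) : \bar R :=
  \int[leb]_s (f s * g (t - s)%R).

Definition laplace (l : R) (f : R -> \bar R) : \bar R :=
  \int[leb]_t ((expR (- l * t))%:E * f t).

Lemma conv_ge0 f g t : (forall s, 0 <= f s) -> (forall s, 0 <= g s) ->
  0 <= conv f g t.
Proof. by move=> f0 g0; apply: integral_ge0 => s _; rewrite mule_ge0. Qed.

Lemma conv_out (f g : R -> \bar R) t :
  (forall s, (s <= 0)%R -> f s = 0) -> (forall s, (s <= 0)%R -> g s = 0) ->
  (t <= 0)%R -> conv f g t = 0.
Proof.
move=> f0 g0 t0; apply: integral0_eq => s _.
have [s0|s0] := leP s 0%R; first by rewrite f0 ?mul0e.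
by rewrite [g _]g0 ?mule0//; lra.
Qed.

Lemma laplace_ge0 l f : (forall t, 0 <= f t) -> 0 <= laplace l f.
Proof.
by move=> f0; apply: integral_ge0 => t _; rewrite mule_ge0// lee_fin expR_ge0.
Qed.

Lemma measurable_expR_scale (l : R) :
  measurable_fun [set: R] (fun t : R => (expR (- l * t))%:E).
Proof.
apply/measurable_EFinP; apply: measurableT_comp; first exact: measurable_expR.
by apply: measurable_funM; [exact: measurable_cst|exact: measurable_id].
Qed.

Lemma laplace_le l f g : measurable_fun [set: R] f -> measurable_fun [set: R] g ->
  (forall t, 0 <= f t) -> (forall t, f t <= g t) -> laplace l f <= laplace l g.
Proof.
move=> mf mg f0 fg; have g0 t := le_trans (f0 t) (fg t).
have e0 t : 0 <= (expR (- l * t))%:E by rewrite lee_fin expR_ge0.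
apply: ge0_le_integral => //.
- by move=> t _; rewrite mule_ge0.
- by apply: emeasurable_funM => //; exact: measurable_expR_scale.
- by apply: emeasurable_funM => //; exact: measurable_expR_scale.
- by move=> t _; rewrite lee_wpmul2l.
Qed.

(** The vanishing for nonpositive times is what makes the weight
    exp(- l t) decreasing in l on the support of f. *)
Lemma laplace_le_rate l l' f : (l' <= l)%R -> measurable_fun [set: R] f ->
  (forall t, 0 <= f t) -> (forall t, (t <= 0)%R -> f t = 0) ->
  laplace l f <= laplace l' f.
Proof.
move=> ll' mf f0 fout; apply: ge0_le_integral => //.
- by move=> t _; rewrite mule_ge0// lee_fin expR_ge0.
- by apply: emeasurable_funM => //; exact: measurable_expR_scale.
- by apply: emeasurable_funM => //; exact: measurable_expR_scale.
- move=> t _; have [t0|t0] := leP t 0%R; first by rewrite fout// !mule0.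
  by rewrite lee_wpmul2r// lee_fin ler_expR ler_pM2r// lerN2.
Qed.

Lemma measurable_conv {d : measure_display} {T : measurableType d}
    (f g : R * T -> \bar R) :
  measurable_fun [set: R * T] f -> (forall q, 0 <= f q) ->
  measurable_fun [set: R * T] g -> (forall q, 0 <= g q) ->
  measurable_fun [set: R * T]
    (fun q => conv (fun s => f (s, q.2)) (fun s => g (s, q.2)) q.1).
Proof.
move=> mf f0 mg g0.
pose h (q : (R * T) * R) := f (q.2, q.1.2) * g ((q.1.1 - q.2)%R, q.1.2).
apply: (@measurable_fun_fubini_tonelli_F _ _ _ _ _ leb h); last first.
  by move=> q; rewrite mule_ge0.
apply: emeasurable_funM.
  apply: (measurableT_comp mf); apply: measurable_fun_pair => //.
  exact: measurableT_comp.
apply: (measurableT_comp mg); apply: measurable_fun_pair.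
  by apply: measurable_funB => //; exact: measurableT_comp.
exact: measurableT_comp.
Qed.

(** Instance of [measurable_conv] with a dummy parameter. *)
Lemma measurable_conv1 (f g : R -> \bar R) :
  measurable_fun [set: R] f -> (forall s, 0 <= f s) ->
  measurable_fun [set: R] g -> (forall s, 0 <= g s) ->
  measurable_fun [set: R] (conv f g).
Proof.
move=> mf f0 mg g0.
have H := @measurable_conv _ R (f \o fst) (g \o fst)
  (measurableT_comp mf measurable_fst) (fun q => f0 q.1)
  (measurableT_comp mg measurable_fst) (fun q => g0 q.1).
exact: (measurable_fun_pair1 (0%R : R) H).
Qed.

(** Tonelli with the inner domain restricted to a measurable subset, obtained
    by extending the integrand by zero. *)
Section tonelli_on_subset.
Context {d1 d2 : measure_display} {T1 : measurableType d1}
  {T2 : measurableType d2}.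
Variables (m1 : {sigma_finite_measure set T1 -> \bar R})
  (m2 : {sigma_finite_measure set T2 -> \bar R}).
Variables (A : set T2) (f : T1 * T2 -> \bar R).
Hypotheses (mA : measurable A) (mf : measurable_fun [set: T1 * T2] f)
  (f0 : forall q, 0 <= f q).

Let g := f \_ ([set: T1] `*` A).

Let mg : measurable_fun [set: T1 * T2] g.
Proof.
apply/(measurable_restrictT f); first exact: measurableX.
exact: measurable_funTS.
Qed.

Let g0 q : 0 <= g q. Proof. by rewrite /g patchE; case: ifP. Qed.

Let gE x y : g (x, y) = ((fun y => f (x, y)) \_ A) y.
Proof.
by rewrite /g !patchE; congr (if _ then _ else _); rewrite in_setX in_setT.
Qed.

Lemma measurable_fun_integral_on :
  measurable_fun [set: T1] (fun x => \int[m2]_(y in A) f (x, y)).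
Proof.
rewrite (_ : (fun x => _) = fun x => \int[m2]_y g (x, y)).
  exact: (@measurable_fun_fubini_tonelli_F _ _ _ _ _ m2 _ mg g0).
apply/funext => x; rewrite integral_mkcond.
by apply: eq_integral => y _; rewrite gE.
Qed.

Lemma tonelli_on :
  \int[m1]_x \int[m2]_(y in A) f (x, y) = \int[m2]_(y in A) \int[m1]_x f (x, y).
Proof.
transitivity (\int[m1]_x \int[m2]_y g (x, y)).
  apply: eq_integral => x _; rewrite integral_mkcond.
  by apply: eq_integral => y _; rewrite gE.
rewrite (fubini_tonelli _ mg g0) [RHS]integral_mkcond.
apply: eq_integral => y _; rewrite patchE; case: ifPn => yA.
  by apply: eq_integral => x _; rewrite gE patchE yA.
by apply: integral0_eq => x _; rewrite gE patchE (negbTE yA).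
Qed.

End tonelli_on_subset.

Section integral_of_conv.
Context {d : measure_display} {T : measurableType d}.
Variables (m : {sigma_finite_measure set T -> \bar R}).
Variables (f : R -> \bar R) (u : R * T -> \bar R).
Hypotheses (mf : measurable_fun [set: R] f) (f0 : forall s, 0 <= f s).
Hypotheses (mfu : measurable_fun [set: R * T] u) (u0 : forall q, 0 <= u q).

Lemma integral_conv_r (A : set T) t : measurable A ->
  \int[m]_(y in A) conv f (fun s => u (s, y)) t =
  conv f (fun s => \int[m]_(y in A) u (s, y)) t.
Proof.
move=> mA; rewrite /conv.
have mg : measurable_fun [set: R * T] (fun q => f q.1 * u ((t - q.1)%R, q.2)).
  apply: emeasurable_funM; first exact: measurableT_comp.
  apply: (measurableT_comp mfu); apply: measurable_fun_pair => //.
  by apply: measurable_funB => //; exact: measurable_cst.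
apply: etrans (esym (@tonelli_on _ _ _ _ leb m A _ mA mg _)) _.
  by move=> q; rewrite mule_ge0.
apply: eq_integral => s _ /=; rewrite ge0_integralZl//.
exact/measurable_funTS/measurable_fun_pair2.
Qed.

Lemma integral_conv_l t :
  \int[m]_y conv (fun s => u (s, y)) f t =
  conv (fun s => \int[m]_y u (s, y)) f t.
Proof.
rewrite /conv.
have mg : measurable_fun [set: R * T] (fun q => u (q.1, q.2) * f (t - q.1)%R).
  apply: emeasurable_funM.
    by apply: (measurableT_comp mfu); exact: measurable_fun_pair.
  apply: (measurableT_comp mf).
  by apply: measurable_funB => //; exact: measurable_cst.
apply: etrans (esym (@tonelli_on _ _ _ _ leb m setT _ measurableT mg _)) _.
  by move=> q; rewrite mule_ge0.
apply: eq_integral => s _ /=; rewrite ge0_integralZr//.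
exact: measurable_fun_pair2.
Qed.

End integral_of_conv.

(** After exchanging the integrals, exp(- l t) splits as
    exp(- l s) exp(- l (t - s)) and the integral in t is translated by s. *)
Lemma laplace_conv (l : R) (f g : R -> \bar R) :
  measurable_fun [set: R] f -> (forall s, 0 <= f s) ->
  measurable_fun [set: R] g -> (forall s, 0 <= g s) ->
  laplace l (conv f g) = laplace l f * laplace l g.
Proof.
move=> mf f0 mg g0; rewrite /laplace /conv.
pose F (q : R * R) := ((expR (- l * q.1))%:E * (f q.2 * g (q.1 - q.2)%R)).
have e0 t : 0 <= (expR (- l * t))%:E by rewrite lee_fin expR_ge0.
have mF : measurable_fun [set: R * R] F.
  apply: emeasurable_funM.
    exact: (measurableT_comp (measurable_expR_scale l)).
  apply: emeasurable_funM; first exact: measurableT_comp.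
  apply: measurableT_comp => //.
  by apply: measurable_funB; [exact: measurable_fst|exact: measurable_snd].
have F0 q : 0 <= F q by rewrite /F !mule_ge0.
transitivity (\int[leb]_t \int[leb]_s F (t, s)).
  apply: eq_integral => t _; rewrite /F/= ge0_integralZl//.
    apply: emeasurable_funM => //; apply: measurableT_comp => //.
    by apply: measurable_funB => //; exact: measurable_cst.
  by move=> s _; rewrite mule_ge0.
rewrite fubini_tonelli//=.
have mh : measurable_fun [set: R] (fun t => (expR (- l * t))%:E * g t).
  by apply: emeasurable_funM => //; exact: measurable_expR_scale.
rewrite -ge0_integralZr//; last 3 first.
- by apply: emeasurable_funM => //; exact: measurable_expR_scale.
- by move=> s _; rewrite mule_ge0.
- by apply: integral_ge0 => t _; rewrite mule_ge0.
apply: eq_integral => s _.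
rewrite -(ge0_integral_translation _ s mh)//; last first.
  by move=> t; rewrite mule_ge0.
rewrite -ge0_integralZl//; last 3 first.
- apply: (measurableT_comp mh).
  by apply: measurable_funB => //; exact: measurable_cst.
- by move=> t _; rewrite mule_ge0.
- by rewrite mule_ge0.
apply: eq_integral => t _; rewrite /F/=.
by rewrite muleACA -EFinM -expRD -mulrDr subrKC.
Qed.

End convolution.

(** * Exponential decay of the survival probability *)

Section exit_time.
Context {R : realType} {d : nat} {disp : measure_display}
  {Omega : measurableType disp} {P : probability Omega R}.
Notation Rd := 'rV[R]_d.
Variables (alpha : R) (Y : R -> Omega -> Rd).
Hypothesis hY : stable_process P alpha Y.

Let mY t : 0 <= t -> measurable_fun setT (Y t).
Proof. by move: t; case: hY. Qed.

Lemma enorm_scale_delta (a : R) (i : 'I_d) :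
  0 <= a -> enorm (a *: delta_mx 0 i : Rd) = a.
Proof.
move=> a0; rewrite /enorm /dotp (bigD1 i)//= big1 ?addr0.
  by rewrite !mxE !eqxx mulr1 -expr2 sqrtr_sqr ger0_norm.
by move=> j ji; rewrite !mxE eqxx (negbTE ji) mulr0 mul0r.
Qed.

Lemma dotp_scale_delta (a : R) (i : 'I_d) (y : Rd) :
  dotp (a *: delta_mx 0 i) y = a * y ord0 i.
Proof.
rewrite /dotp (bigD1 i)//= big1 ?addr0.
  by rewrite !mxE !eqxx mulr1.
by move=> j ji; rewrite !mxE eqxx (negbTE ji) mulr0 mul0r.
Qed.

Lemma measurable_slab (i : 'I_d) (M : R) :
  measurable [set y : Rd | `|y ord0 i| <= M].
Proof.
rewrite (_ : [set _ | _] = (fun y : Rd => y ord0 i) @^-1` `[- M, M]%classic).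
  by rewrite -[X in measurable X]setTI; exact: measurable_coord.
by apply/seteqP; split => y /=; rewrite in_itv/= ler_norml.
Qed.

(** If |Y_t| stayed below M in coordinate i almost surely, then with the
    frequency a = pi / (4 M) the variable cos (a Y_t) would be at least
    cos (pi / 4), whereas its mean exp (- t a^alpha) is arbitrarily small for
    large t. *)
Lemma leaves_slab (i : 'I_d) (M : R) : 0 < M ->
  exists2 t, 0 < t & (P [set w | (`|Y t w ord0 i| <= M)%R] < 1)%E.
Proof.
move=> M0.
pose a := pi / 4 / M.
have pi_pos := pi_gt0 R.
have a0 : 0 < a by rewrite !divr_gt0.
pose c : R := cos (pi / 4).
have c0 : 0 < c.
  by apply: cos_gt0_pihalf; apply/andP; split; lra.
(* at this time the mean of cos (a Y_t) equals c / 2 *)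
pose t := - ln (c / 2) / (a `^ alpha).
have aa0 : 0 < a `^ alpha by rewrite powR_gt0.
have c1 : c <= 1 := cos_le1 _.
have t0 : 0 < t.
  by rewrite divr_gt0// oppr_gt0 ln_lt0//; apply/andP; split; lra.
exists t => //; rewrite ltNge; apply/negP => PB.
set B := [set w | _] in PB.
have mB : measurable B.
  rewrite (_ : B = Y t @^-1` [set y : Rd | `|y ord0 i| <= M])//.
  rewrite -[X in measurable X]setTI; apply: mY => //; first exact: ltW.
  exact: measurable_slab.
pose X w : R := cos (a * Y t w ord0 i).
have mX : measurable_fun setT X.
  apply: measurableT_comp; first exact: (continuous_measurable_fun (@continuous_cos R)).
  apply: measurable_funM; first exact: measurable_cst.
  apply: (measurableT_comp (measurable_coord i)).
  exact/mY/ltW.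
have XB w : B w -> c <= X w.
  move=> Bw; rewrite /X -cos_norm /c.
  have h : `|a * Y t w ord0 i| <= pi / 4.
    rewrite normrM gtr0_norm// (_ : pi / 4 = a * M).
      by rewrite ler_pM2l.
    by rewrite /a divfK ?gt_eqF.
  rewrite leNgt ltr_cos ?in_itv/= ?normr_ge0/= -?leNgt//; last lra.
  by apply/andP; split; lra.
have E : (\int[P]_w (X w)%:E = (expR (- t * a `^ alpha))%:E)%E.
  have [_ _ _ [_ _ /(_ t (a *: delta_mx 0 i) (ltW t0)) [+ _]]] := hY.
  rewrite enorm_scale_delta ?ltW// => <-; rewrite unlock.
  by apply: eq_integral => w _; rewrite dotp_scale_delta.
have : (c%:E <= \int[P]_w (X w)%:E)%E.
  rewrite -[leLHS]mule1 -(probability_setT P) -integral_cst//.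
  rewrite [leRHS](@ae_eq_integral _ _ _ P setT (fun w => (Num.max (X w) c)%:E))//.
  - apply: ge0_le_integral => //.
    + by move=> w _; rewrite lee_fin ltW.
    + by apply/measurable_EFinP; apply: measurable_maxr.
    + by move=> w _; rewrite lee_fin le_max lexx orbT.
  - exact/measurable_EFinP.
  - by apply/measurable_EFinP; apply: measurable_maxr.
  - exists (~` B); split; first exact: measurableC.
      rewrite [LHS](probability_setC P mB).
      have -> : P B = 1%E by apply/eqP; rewrite eq_le PB probability_le1.
      by rewrite subee.
    move=> w /= nw Bw; apply: nw => _; congr EFin.
    by apply/esym/max_idPl/XB.
rewrite E lee_fin.
have -> : - t * a `^ alpha = ln (c / 2).
  by rewrite /t mulNr divfK ?gt_eqF// opprK.
by rewrite lnK ?posrE ?divr_gt0//; lra.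
Qed.
(** A path staying in [D] up to time t makes, between the times s, 2s, ...,
    n.+1 * s, increments bounded by the width M + M of [D] in coordinate i,
    and these are independent and equidistributed.  The first time is s and
    not 0 because the exit time only constrains positive times. *)
Lemma survival_le_expe (D : set Rd) (p : R -> Rd -> Rd -> R)
    (i : 'I_d) (M s t : R) (n : nat) (x : Rd) :
  dirichlet_heat_kernel P Y D p -> measurable D ->
  (forall y, D y -> `|y ord0 i| <= M) ->
  0 < s -> n.+1%:R * s <= t -> D x ->
  (\int[lebesgue_rV d]_(y in D) (p t x y)%:E <=
   P [set w | (`|Y s w ord0 i| <= M + M)%R] ^+ n)%E.
Proof.
move=> [_ _ hp] mD DM s0 nst Dx.
have t0 : 0 < t by apply: lt_le_trans nst; rewrite mulr_gt0.
(* E1 is a measurable part of the survival event of the same probability *)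
have [E1 [E2 [mE1 _ E1E _ [<- _]]]] := hp t x D t0 Dx mD (@subset_refl _ D).
pose B := [set y : Rd | `|y ord0 i| <= M + M].
have mB : measurable B := measurable_slab i (M + M).
pose tau k : R := k.+1%:R * s.
have tau0 k : 0 <= tau k by rewrite mulr_ge0// ltW.
have [_ _ indep [stat _ _]] := hY.
have := indep n tau (fun=> B) (tau0 0%N) _ (fun=> mB).
rewrite (eq_bigr (fun=> P [set w | B (Y s w)])); last first.
  move=> k _; have -> : tau k.+1 = tau k + s by rewrite /tau; ring.
  by rewrite stat// ltW.
rewrite big_const card_ord iter_mule mule1.
move=> <-; last first.
  by move=> k; rewrite /tau ler_pM2r// ler_nat.
apply: le_measure; rewrite ?inE//.
  apply: bigcap_measurableType => k _.
  have mdY : measurable_fun setT (fun w => Y (tau k.+1) w - Y (tau k) w).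
    apply: measurable_fun_rV => j.
    rewrite (_ : (fun w => _) =
        fun w => Y (tau k.+1) w ord0 j - Y (tau k) w ord0 j).
      by apply: measurable_funB; apply: (measurableT_comp (measurable_coord j));
        exact: mY.
    by rewrite funeqE => w; rewrite !mxE.
  by rewrite -[X in measurable X]setTI; exact: mdY.
apply: (subset_trans E1E) => w [_ tw] k /= kn.
have Dw r : 0 < r -> r <= t -> D (x + Y r w).
  move=> r0 rt; apply: contrapT => nD.
  have : (exit_time D (fun s w' => (x + Y s w')%R) w <= r%:E)%E.
    by apply: ereal_inf_lbound; exists r.
  by move=> /(lt_le_trans tw); rewrite lte_fin ltNge rt.
have taut j : (j <= n)%N -> tau j <= t.
  by move=> jn; apply: le_trans nst; rewrite /tau ler_pM2r// ler_nat ltnS.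
have taup j : 0 < tau j by rewrite mulr_gt0.
have := DM _ (Dw _ (taup k.+1) (taut _ kn)).
have := DM _ (Dw _ (taup k) (taut _ (ltnW kn))).
rewrite /B/= !mxE !ler_norml => /andP[? ?] /andP[? ?]; apply/andP; split; lra.
Qed.

Lemma survival_le_expR (D : set Rd) (p : R -> Rd -> Rd -> R) :
  dirichlet_heat_kernel P Y D p -> measurable D -> bounded_set D -> (0 < d)%N ->
  exists C b : R, [/\ 0 < C, 0 < b & forall t x, 0 < t -> D x ->
    (\int[lebesgue_rV d]_(y in D) (p t x y)%:E <= (C * expR (- b * t))%:E)%E].
Proof.
move=> hp mD bD d0; pose i := Ordinal d0.
have [M M0 DM] : exists2 M, 0 < M & forall y, D y -> `|y ord0 i| <= M.
  have [M [_ HM]] := bD; exists (`|M| + 1); first by rewrite ltr_wpDl.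
  move=> y Dy; apply: le_trans (HM (`|M| + 1) _ y Dy); last first.
    by rewrite (le_lt_trans (ler_norm M))// ltrDl.
  rewrite /Num.norm/= mx_normrE.
  by apply: le_trans (le_bigmax _ _ (ord0, i)).
have [s s0 rho1] := leaves_slab i (M + M) (addr_gt0 M0 M0).
set rho := P _ in rho1.
have rhofin : rho \is a fin_num.
  rewrite ge0_fin_numE; first exact: lt_le_trans rho1 (leey _).
  exact: measure_ge0.
have rhoE : rho = (fine rho)%:E by rewrite fineK.
have r1 : fine rho < 1 by rewrite -lte_fin -rhoE.
have r0 : 0 <= fine rho by rewrite fine_ge0// measure_ge0.
(* rho may vanish; a positive upper bound r < 1 has a logarithm *)
pose r : R := Num.max (fine rho) (1 / 2).
have rp : 0 < r by rewrite /r lt_max; apply/orP; right; lra.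
have rl1 : r < 1 by rewrite /r gt_max r1/=; lra.
pose b := - ln r / s.
have b0 : 0 < b by rewrite divr_gt0// oppr_gt0 ln_lt0// rp.
have rE n : r ^+ n = expR (- b * (n%:R * s)).
  have -> : - b * (n%:R * s) = n%:R * ln r.
    by rewrite /b !mulNr opprK mulrCA divfK ?gt_eqF.
  by rewrite expRM_natl lnK.
exists (expR (b * (2 * s))), b; split => //; first exact: expR_gt0.
move=> t x t0 Dx; rewrite -expRD.
have key n : n.+1%:R * s <= t -> t <= n.+2%:R * s ->
  (\int[lebesgue_rV d]_(y in D) (p t x y)%:E <=
     (expR (b * (2 * s) + - b * t))%:E)%E.
  move=> h1 h2.
  apply: le_trans (survival_le_expe _ _ _ _ _ _ n _ hp mD DM s0 h1 Dx) _.
  rewrite -/rho rhoE -EFin_expe lee_fin.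
  apply: (@le_trans _ _ (r ^+ n)); 
    first by rewrite lerXn2r ?nnegrE ?(ltW rp)// le_max lexx.
  have : b * t <= b * (n.+2%:R * s) by rewrite ler_pM2l.
  by rewrite rE ler_expR -addn2 natrD; lra.
(* for t < s the bound is that of a probability: zero increments of span t *)
have [ts|st] := ltP t s.
  apply: le_trans (survival_le_expe _ _ _ _ t _ 0%N _ hp mD DM t0 _ Dx) _.
    by rewrite mul1r.
  rewrite expe0 lee_fin mulNr -mulrBr -[leLHS]expR0 ler_expR mulr_ge0 ?(ltW b0)//.
  by lra.
have : 1 <= t / s by rewrite ler_pdivlMr// mul1r.
rewrite -truncn_gt0; case E : (Num.truncn (t / s)) => [//|n] _.
have /truncn_itv : 0 <= t / s by rewrite divr_ge0// ltW.
rewrite E => /andP[h1 h2]; apply: (key n); first by rewrite -ler_pdivlMr.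
by rewrite -ler_pdivrMr// ltW.
Qed.

End exit_time.

(** * Series, multiples of a measure, and a limit *)

Lemma balance_limit (R : realType) (a e a' e' : nat -> R) (q a0 e0 : R) :
  (forall n, a n * (1 - e' n) = (q - a' n) * e n) ->
  a n @[n --> \oo] --> a0 -> e n @[n --> \oo] --> e0 ->
  a' n @[n --> \oo] --> 0 -> e' n @[n --> \oo] --> 0 -> a0 = q * e0.
Proof.
move=> H ha he ha' he'.
have L : (a n * (1 - e' n)) @[n --> \oo] --> a0 * (1 - 0).
  by apply: cvgM => //; apply: cvgB => //; exact: cvg_cst.
have L' : ((q - a' n) * e n) @[n --> \oo] --> (q - 0) * e0.
  by apply: cvgM => //; apply: cvgB => //; exact: cvg_cst.
rewrite -[a0]mulr1 -[in LHS](subr0 1) -[q](subr0 q).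
by apply: cvg_unique L _ => //; rewrite (funext H).
Qed.

Section constant_multiple.
Local Open Scope ereal_scope.
Context {R : realType}.

Lemma nneseries_cst (c : \bar R) : 0 <= c ->
  \sum_(0 <= n <oo) c = +oo * c.
Proof.
move=> c0; rewrite -(@ge0_integral_count R (fun=> c))//.
rewrite (integral_cst counting measurableT) muleC; congr (_ * _).
by rewrite /= /counting asboolF//; exact: infinite_nat.
Qed.

(** The factor [c] may be infinite. *)
Lemma nneseries_mulr (a : nat -> \bar R) (c : \bar R) :
  (forall n, 0 <= a n) -> 0 <= c ->
  \sum_(0 <= n <oo) (a n * c) = (\sum_(0 <= n <oo) a n) * c.
Proof.
move=> a0 c0; rewrite -(ge0_integral_count a0).
rewrite -(@ge0_integral_count R (fun n => a n * c)).
  by rewrite (ge0_integralZr counting measurableT).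
by move=> n; rewrite mule_ge0.
Qed.

(** An infinite factor is allowed: the measure +oo * m is the sum of
    countably many copies of m. *)
Lemma integral_measure_multiple d (T : measurableType d)
    (M m : {measure set T -> \bar R}) (k : \bar R) (A : set T) (g : T -> \bar R) :
  0 <= k -> measurable A ->
  (forall B, measurable B -> M B = k * m B) ->
  measurable_fun A g -> (forall x, A x -> 0 <= g x) ->
  \int[M]_(x in A) g x = k * \int[m]_(x in A) g x.
Proof.
move=> k0 mA MB mg g0.
case: k k0 MB => [r| |//].
- rewrite lee_fin => r0 MB.
  rewrite -[r%:E]/((NngNum r0)%:num%:E) -ge0_integral_mscale//.
  by apply: eq_measure_integral => B mB _; rewrite [LHS]MB.
- move=> _ MB; rewrite -nneseries_cst; last exact: integral_ge0.
  rewrite -ge0_integral_measure_series//.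
  apply: eq_measure_integral => B mB _; rewrite [LHS]MB//.
  by rewrite -nneseries_cst.
Qed.

End constant_multiple.

(** * The killing rate and the jump kernel for a constant reflection law *)

Section killing.
Local Open Scope ereal_scope.
Context {R : realType} {d : nat}.
Notation Rd := 'rV[R]_d.
Variables (alpha : R) (D : set Rd).
Hypotheses (alpha_gt0 : (0 < alpha)%R) (mD : measurable D).

Definition killing_rate (v : Rd) : \bar R :=
  \int[lebesgue_rV d]_(z in ~` D) (nu alpha v z)%:E.

Lemma nu_ge0 (v z : Rd) : (0 <= nu alpha v z)%R.
Proof.
have a0 : (0 < (d%:R + alpha) / 2)%R by rewrite divr_gt0// ltr_wpDl.
rewrite /nu mulr_ge0 ?powR_ge0// /stable_const divr_ge0//.
  rewrite mulr_ge0 ?powR_ge0// /Gamma a0; apply: Rintegral_ge0 => t _.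
  by rewrite mulr_ge0 ?powR_ge0 ?expR_ge0.
by rewrite mulr_ge0 ?powR_ge0.
Qed.

Lemma measurable_nu : measurable_fun [set: Rd * Rd] (fun q => (nu alpha q.1 q.2)%:E).
Proof.
apply/measurable_EFinP; apply: measurable_funM; first exact: measurable_cst.
apply: (measurableT_comp (measurable_powR (- d%:R - alpha))).
apply: (measurableT_comp measurable_enorm).
apply: measurable_fun_rV => i.
rewrite (_ : (fun x => _) = fun q : Rd * Rd => (q.1 ord0 i - q.2 ord0 i)%R).
  by apply: measurable_funB; apply: (measurableT_comp (measurable_coord i)).
by rewrite funeqE => x; rewrite !mxE.
Qed.

Lemma killing_rate_ge0 v : 0 <= killing_rate v.
Proof. by apply: integral_ge0 => z _; rewrite lee_fin nu_ge0. Qed.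

Lemma measurable_killing_rate : measurable_fun [set: Rd] killing_rate.
Proof.
apply: (@measurable_fun_integral_on _ _ _ _ _ _ _ _ (measurableC mD) measurable_nu).
by move=> q; rewrite lee_fin nu_ge0.
Qed.

(** For a constant reflection law, jumping out of [D] from [v] and being
    reflected amounts to restarting from [m] at rate [killing_rate v].  The
    set function [nu_mu v] is promoted to a measure by
    [nu_mu_sigma_additive]; hence the integrand [f] is given through its
    values on [D] only. *)
Lemma integral_nu_mu (mu : Rd -> probability Rd R) (m : probability Rd R)
    (f g : Rd -> \bar R) (v : Rd) :
  reflection_kernel D mu ->
  (forall w (A : set Rd), ~ D w -> measurable A -> mu w A = m A) ->
  measurable_fun D g -> (forall x, D x -> 0 <= g x) ->
  (forall x, D x -> f x = g x) ->
  \int[nu_mu D mu alpha v]_(w in D) f w =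
  killing_rate v * \int[m]_(w in D) g w.
Proof.
move=> hmu hm mg g0 fg.
have [h0 h1 h2] := nu_mu_sigma_additive v alpha_gt0 mD hmu.
pose M : {measure set Rd -> \bar R} := HB.pack (nu_mu D mu alpha v)
  (isMeasure.Build _ _ _ (nu_mu D mu alpha v) h0 h1 h2).
transitivity (\int[M]_(w in D) g w).
  by apply: (@eq_integral _ _ _ M) => w /set_mem; exact: fg.
apply: (@integral_measure_multiple _ _ _ M m) => //.
  exact: killing_rate_ge0.
move=> B mB; rewrite /killing_rate -ge0_integralZr//.
- by apply: eq_integral => z /set_mem zD; rewrite hm.
- exact: measurableC.
- by apply/measurable_funTS; exact: measurable_fun_pair2 measurable_nu.
- by move=> z _; rewrite lee_fin nu_ge0.
Qed.

End killing.

(** * The renewal structure of the reflected semigroup *)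

Section renewal.
Local Open Scope ereal_scope.
Context {R : realType} {d : nat}.
Notation Rd := 'rV[R]_d.
Notation leb := (@lebesgue_measure R).
Variables (alpha : R) (D : set Rd) (p : R -> Rd -> Rd -> R).
Hypotheses (alpha_gt0 : (0 < alpha)%R) (oD : open D).
Hypothesis p_ge0 : forall t x y, (0 < t)%R -> D x -> D y -> (0 <= p t x y)%R.
Hypothesis p_cont : forall t x y, (0 < t)%R -> D x -> D y ->
  {for (t, x, y), continuous (fun q : R * Rd * Rd => p q.1.1 q.1.2 q.2)}.
Variable m : probability Rd R.
Hypothesis mD1 : m D = 1.

Let mD : measurable D := open_measurable_rV R d D oD.

Let dom : set (R * Rd * Rd) := [set q | [/\ (0 < q.1.1)%R, D q.1.2 & D q.2]].

Let open_dom : open dom.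
Proof.
rewrite openE => -[[t x] y] [/= t0 Dx Dy].
exists ([set r | (0 < r)%R] `*` D, D).
  split => /=; last exact: open_nbhs_nbhs.
  exists ([set r | (0 < r)%R], D) => //=; split; exact: open_nbhs_nbhs.
by move=> -[[t' x'] y'] [/= [? ?] ?]; split.
Qed.

(** The heat kernel extended by zero, which removes all domain conditions
    from the integrals below. *)
Definition heat (q : R * Rd * Rd) : \bar R :=
  ((fun q : R * Rd * Rd => (p q.1.1 q.1.2 q.2)%:E) \_ dom) q.

Lemma heatE t x y : (0 < t)%R -> D x -> D y -> heat (t, x, y) = (p t x y)%:E.
Proof. by move=> t0 Dx Dy; rewrite /heat patchE mem_set. Qed.

Lemma heat_out t x y : ~ [/\ (0 < t)%R, D x & D y] -> heat (t, x, y) = 0.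
Proof. by move=> n; rewrite /heat patchE memNset. Qed.

Lemma heat_ge0 q : 0 <= heat q.
Proof.
rewrite /heat patchE; case: ifPn => // /set_mem[? ? ?].
by rewrite lee_fin p_ge0.
Qed.

Lemma measurable_heat : measurable_fun [set: R * Rd * Rd] heat.
Proof.
have mdom : measurable dom by exact: open_measurable_time_space2.
have H : measurable_fun dom (fun q : R * Rd * Rd => p q.1.1 q.1.2 q.2).
  apply: measurable_fun_continuous_on_open; first exact: open_dom.
  by move=> [[t x] y] [? ? ?]; exact: p_cont.
apply/(measurable_restrictT (fun q : R * Rd * Rd => (p q.1.1 q.1.2 q.2)%:E)) => //.
exact/measurable_EFinP.
Qed.

(** The density at time s of the jump out of [D], started from x. *)
Definition exit_density (q : R * Rd) : \bar R :=
  \int[lebesgue_rV d]_(v in D) (heat (q, v) * killing_rate alpha D v).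

Lemma exit_density_ge0 q : 0 <= exit_density q.
Proof.
by apply: integral_ge0 => v _; rewrite mule_ge0 ?heat_ge0 ?killing_rate_ge0.
Qed.

Lemma measurable_exit_density : measurable_fun [set: R * Rd] exit_density.
Proof.
apply: (@measurable_fun_integral_on _ _ _ _ _ _ _
  (fun q : (R * Rd) * Rd => heat q * killing_rate alpha D q.2)) => //.
  apply: emeasurable_funM; first exact: measurable_heat.
  exact: (measurableT_comp (measurable_killing_rate alpha D alpha_gt0 mD) measurable_snd).
by move=> q; rewrite mule_ge0 ?heat_ge0 ?killing_rate_ge0.
Qed.

Lemma exit_density_out t x : ~ ((0 < t)%R /\ D x) -> exit_density (t, x) = 0.
Proof.
move=> n; apply: integral0_eq => v _.
by rewrite heat_out ?mul0e// => -[? ? ?]; apply: n.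
Qed.

Definition mean_exit_density (m' : probability Rd R) (s : R) : \bar R :=
  \int[m']_x exit_density (s, x).

Lemma mean_exit_density_ge0 m' s : 0 <= mean_exit_density m' s.
Proof. by apply: integral_ge0 => x _; exact: exit_density_ge0. Qed.

Lemma measurable_mean_exit_density m' :
  measurable_fun [set: R] (mean_exit_density m').
Proof.
apply: (@measurable_fun_integral_on _ _ _ _ _ m' setT exit_density) => //.
  exact: measurable_exit_density.
exact: exit_density_ge0.
Qed.

Lemma mean_exit_density_out m' s : (s <= 0)%R -> mean_exit_density m' s = 0.
Proof.
move=> s0; apply: integral0_eq => x _.
by rewrite exit_density_out// => -[]; rewrite ltNge s0.
Qed.

(** The density at time t of the process started from the law [m] and
    observed after exactly n reflections, all of which restart from [m]. *)
Fixpoint reborn (n : nat) (q : R * Rd) : \bar R :=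
  if n is n'.+1 then
    conv (mean_exit_density m) (fun s => reborn n' (s, q.2)) q.1
  else \int[m]_x heat (q.1, x, q.2).

Lemma reborn_ge0 n q : 0 <= reborn n q.
Proof.
elim: n q => [|n IH] q /=; first by apply: integral_ge0 => x _; exact: heat_ge0.
by apply: conv_ge0 => // s; exact: mean_exit_density_ge0.
Qed.

Lemma measurable_reborn n : measurable_fun [set: R * Rd] (reborn n).
Proof.
elim: n => [|n IH] /=.
  apply: (@measurable_fun_integral_on _ _ _ _ _ m setT
    (fun q : (R * Rd) * Rd => heat (q.1.1, q.2, q.1.2))) => //.
    apply: (measurableT_comp measurable_heat).
    apply: measurable_fun_pair; last exact: measurableT_comp.
    by apply: measurable_fun_pair => //; exact: measurableT_comp.
  by move=> q; exact: heat_ge0.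
apply: (@measurable_conv _ _ _ (fun q => mean_exit_density m q.1) (reborn n)) => //.
- by apply: (measurableT_comp (measurable_mean_exit_density m)).
- by move=> q; exact: mean_exit_density_ge0.
- exact: reborn_ge0.
Qed.

Lemma reborn_out n t y : (t <= 0)%R -> reborn n (t, y) = 0.
Proof.
elim: n t => [|n IH] t t0 /=.
  by apply: integral0_eq => x _; rewrite heat_out// => -[]; rewrite ltNge t0.
by apply: conv_out => // s; exact: mean_exit_density_out.
Qed.

(** The closed form of [kn]: all reflections but the first take place in an
    evolution started from [m], so that x only enters through the first
    exit. *)
Definition kernel_term (n : nat) (q : R * Rd * Rd) : \bar R :=
  if n is n'.+1 then
    conv (fun s => exit_density (s, q.1.2)) (fun s => reborn n' (s, q.2)) q.1.1
  else heat q.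

Lemma kernel_term_ge0 n q : 0 <= kernel_term n q.
Proof.
case: n => [|n] /=; first exact: heat_ge0.
by apply: conv_ge0 => s; [exact: exit_density_ge0|exact: reborn_ge0].
Qed.

Lemma measurable_kernel_term n : measurable_fun [set: R * Rd * Rd] (kernel_term n).
Proof.
case: n => [|n]; first exact: measurable_heat.
have H : measurable_fun [set: R * (Rd * Rd)]
    (fun q => conv (fun s => exit_density (s, q.2.1))
                   (fun s => reborn n (s, q.2.2)) q.1).
  apply: (@measurable_conv _ _ _ (fun q : R * (Rd * Rd) => exit_density (q.1, q.2.1))
    (fun q : R * (Rd * Rd) => reborn n (q.1, q.2.2))).
  - apply: (measurableT_comp measurable_exit_density).
    by apply: measurable_fun_pair => //; exact: measurableT_comp.
  - by move=> q; exact: exit_density_ge0.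
  - apply: (measurableT_comp (measurable_reborn n)).
    by apply: measurable_fun_pair => //; exact: measurableT_comp.
  - by move=> q; exact: reborn_ge0.
pose e (q : R * Rd * Rd) := (q.1.1, (q.1.2, q.2)).
have me : measurable_fun [set: R * Rd * Rd] e.
  apply: measurable_fun_pair; first exact: measurableT_comp.
  by apply: measurable_fun_pair => //; exact: measurableT_comp.
exact: (measurableT_comp H me).
Qed.

Lemma integral_kernel_term n t y :
  \int[m]_x kernel_term n (t, x, y) = reborn n (t, y).
Proof.
case: n => [//|n] /=.
apply: (@integral_conv_l _ _ _ m (fun s => reborn n (s, y)) exit_density).
- exact: (measurable_fun_pair1 y (measurable_reborn n)).
- by move=> s; exact: reborn_ge0.
- exact: measurable_exit_density.
- exact: exit_density_ge0.
Qed.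

Lemma integral_prob_on (m' : probability Rd R) (g : Rd -> \bar R) :
  m' D = 1 -> measurable_fun [set: Rd] g -> (forall x, 0 <= g x) ->
  \int[m']_(x in D) g x = \int[m']_x g x.
Proof.
move=> m'D mg g0; rewrite [RHS](@ge0_negligible_integral _ _ _ _ _ (~` D))//.
- by rewrite setTD setCK.
- exact: measurableC.
- by rewrite [LHS](probability_setC m' mD) m'D subee.
Qed.

Section kernel.
Variable mu : Rd -> probability Rd R.
Hypotheses (hmu : reflection_kernel D mu)
  (hmum : forall w (A : set Rd), ~ D w -> measurable A -> mu w A = m A).

Lemma kn_kernel_term n t x y : (0 < t)%R -> D x -> D y ->
  kn D mu alpha p n t x y = kernel_term n (t, x, y).
Proof.
elim: n t x y => [|n IH] t x y t0 Dx Dy /=; first by rewrite heatE.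
have step s v : `]0%R, t[%classic s -> D v ->
    \int[nu_mu D mu alpha v]_(w in D)
      ((p s x v)%:E * kn D mu alpha p n (t - s)%R w y) =
    heat (s, x, v) * killing_rate alpha D v * reborn n ((t - s)%R, y).
  rewrite /= in_itv/= => /andP[s0 st] Dv.
  have mk : measurable_fun [set: Rd] (fun w => kernel_term n ((t - s)%R, w, y)).
    exact: (measurable_fun_pair2 (t - s)%R
      (measurable_fun_pair1 y (measurable_kernel_term n))).
  rewrite (integral_nu_mu alpha D alpha_gt0 mD mu m _
    (fun w => heat (s, x, v) * kernel_term n ((t - s)%R, w, y)))//; last 3 first.
  - apply: measurable_funTS; apply: emeasurable_funM => //.
  - by move=> w _; rewrite mule_ge0 ?heat_ge0 ?kernel_term_ge0.
  - by move=> w Dw; rewrite IH ?subr_gt0// heatE.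
  rewrite ge0_integralZl//; last 3 first.
  - exact: measurable_funTS.
  - by move=> w _; exact: kernel_term_ge0.
  - exact: heat_ge0.
  rewrite (integral_prob_on m)//; last by move=> w; exact: kernel_term_ge0.
  by rewrite integral_kernel_term muleA (muleC (killing_rate _ _ _)).
rewrite /conv integral_mkcond; apply: eq_integral => s _.
rewrite patchE; case: ifPn => [/set_mem st|/negP st].
  rewrite /exit_density -ge0_integralZr//; last 3 first.
  - apply: measurable_funTS; apply: emeasurable_funM.
      exact: (measurable_fun_pair2 (s, x) measurable_heat).
    exact: measurable_killing_rate.
  - by move=> v _; rewrite mule_ge0 ?heat_ge0 ?killing_rate_ge0.
  - exact: reborn_ge0.
  by apply: eq_integral => v /set_mem Dv; rewrite step.
have [s0|s0] := leP s 0%R.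
  by rewrite exit_density_out ?mul0e// => -[]; rewrite ltNge s0.
rewrite [reborn _ _]reborn_out ?mule0// subr_le0 leNgt; apply/negP => st'.
by apply: st; rewrite inE/= in_itv/= s0.
Qed.

Variable pi0 : probability Rd R.
Hypothesis hpi0 : stationary D mu alpha p pi0.

Definition heat_mass (m' : probability Rd R) (A : set Rd) (t : R) : \bar R :=
  \int[m']_x \int[lebesgue_rV d]_(y in A) heat (t, x, y).

Definition reborn_mass (A : set Rd) (n : nat) (t : R) : \bar R :=
  \int[lebesgue_rV d]_(y in A) reborn n (t, y).

Lemma reborn_mass_ge0 A n t : 0 <= reborn_mass A n t.
Proof. by apply: integral_ge0 => y _; exact: reborn_ge0. Qed.

Lemma measurable_reborn_mass A n :
  measurable A -> measurable_fun [set: R] (reborn_mass A n).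
Proof.
move=> mA; apply: (@measurable_fun_integral_on _ _ _ _ _ _ A (reborn n)) => //.
  exact: measurable_reborn.
exact: reborn_ge0.
Qed.

Lemma reborn_massS A n : measurable A ->
  reborn_mass A n.+1 = conv (mean_exit_density m) (reborn_mass A n).
Proof.
move=> mA; apply/funext => t.
apply: (@integral_conv_r _ _ _ (lebesgue_rV d) (mean_exit_density m) (reborn n)) => //.
- exact: measurable_mean_exit_density.
- by move=> s; exact: mean_exit_density_ge0.
- exact: measurable_reborn.
- exact: reborn_ge0.
Qed.

Lemma reborn_mass0 A : measurable A -> reborn_mass A 0 = heat_mass m A.
Proof.
move=> mA; apply/funext => t; apply/esym.
apply: (tonelli_on m (lebesgue_rV d) A
  (fun q : Rd * Rd => heat (t, q.1, q.2))) => //.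
  apply: (measurableT_comp measurable_heat).
  apply: measurable_fun_pair; last exact: measurable_snd.
  by apply: measurable_fun_pair => //; exact: measurable_fst.
by move=> q; exact: heat_ge0.
Qed.

Lemma heat_mass_ge0 m' A t : 0 <= heat_mass m' A t.
Proof.
by apply: integral_ge0 => x _; apply: integral_ge0 => y _; exact: heat_ge0.
Qed.

Lemma heat_mass_out m' A t : (t <= 0)%R -> heat_mass m' A t = 0.
Proof.
move=> t0; apply: integral0_eq => x _; apply: integral0_eq => y _.
by rewrite heat_out// => -[]; rewrite ltNge t0.
Qed.

Lemma measurable_heat_mass m' A :
  measurable A -> measurable_fun [set: R] (heat_mass m' A).
Proof.
move=> mA.
apply: (@measurable_fun_integral_on _ _ _ _ _ m' setT
  (fun q : R * Rd => \int[lebesgue_rV d]_(y in A) heat (q, y))) => //.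
  apply: (@measurable_fun_integral_on _ _ _ _ _ _ A heat) => //.
  - exact: measurable_heat.
  - exact: heat_ge0.
by move=> q; apply: integral_ge0 => y _; exact: heat_ge0.
Qed.

(** Stationarity is tested on the indicator function of [A]. *)
Lemma stationary_renewal (A : set Rd) (t : R) :
  measurable A -> A `<=` D -> (0 < t)%R ->
  pi0 A = heat_mass pi0 A t +
    \sum_(0 <= n <oo) conv (mean_exit_density pi0) (reborn_mass A n) t.
Proof.
move=> mA AD t0; have [piD stat] := hpi0.
have mt n x : measurable_fun [set: Rd] (fun y => kernel_term n (t, x, y)).
  exact: (measurable_fun_pair2 (t, x) (measurable_kernel_term n)).
have KE x : D x -> KK D mu alpha p t (\1_A) x =
    \sum_(0 <= n <oo) \int[lebesgue_rV d]_(y in A) kernel_term n (t, x, y).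
  move=> Dx; rewrite /KK.
  transitivity (\int[lebesgue_rV d]_(y in A)
      \sum_(0 <= n <oo) kernel_term n (t, x, y)).
    rewrite [LHS]integral_mkcond [RHS]integral_mkcond.
    apply: eq_integral => y _; rewrite !patchE indicE.
    case: ifPn => yD; last first.
      by case: ifPn => // /set_mem/AD Dy; rewrite mem_set in yD.
    case: ifPn => yA; last by rewrite mule0.
    rewrite mule1; apply: eq_eseriesr => n _.
    by rewrite kn_kernel_term//; exact: set_mem.
  rewrite integral_nneseries//.
  - by move=> n; exact: measurable_funTS.
  - by move=> n y _; exact: kernel_term_ge0.
have mJ n : measurable_fun [set: Rd]
    (fun x => \int[lebesgue_rV d]_(y in A) kernel_term n (t, x, y)).
  apply: (@measurable_fun_integral_on _ _ _ _ _ _ _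
    (fun q : Rd * Rd => kernel_term n (t, q.1, q.2))) => //.
    apply: (measurableT_comp (measurable_kernel_term n)).
    apply: measurable_fun_pair; last exact: measurable_snd.
    by apply: measurable_fun_pair => //; exact: measurable_fst.
  by move=> q; exact: kernel_term_ge0.
have J0 n x : 0 <= \int[lebesgue_rV d]_(y in A) kernel_term n (t, x, y).
  by apply: integral_ge0 => y _; exact: kernel_term_ge0.
transitivity (\int[pi0]_(x in D) (\1_A x)%:E).
  by rewrite integral_indic// setIidl.
rewrite -(stat (\1_A) t _ _ t0)//; last first.
  exists 1%R => x _; rewrite indicE.
  by case: (x \in A); rewrite ?normr0 ?normr1.
rewrite (eq_integral _ _ (fun x xD => KE x (set_mem xD))).
have mJD n := measurable_funTS (D := D) (mJ n).
rewrite (integral_nneseries _ mD mJD (fun n x _ => J0 n x)).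
rewrite (eq_eseriesr (fun n _ => integral_prob_on pi0 _ piD (mJ n) (J0 n))).
rewrite [LHS]nneseries_recl//; last first.
  by move=> n _; apply: integral_ge0 => x _; exact: J0.
rewrite -[X in _ + X = _](@nneseries_addn _ _ 1); last first.
  by move=> n; apply: integral_ge0 => x _; exact: J0.
congr (_ + _); apply: eq_eseriesr => n _; rewrite addn1.
transitivity (\int[pi0]_x conv (fun s => exit_density (s, x)) (reborn_mass A n) t).
  apply: eq_integral => x _.
  apply: (@integral_conv_r _ _ _ (lebesgue_rV d) (fun s => exit_density (s, x))
    (reborn n)) => //.
  - exact: (measurable_fun_pair1 x measurable_exit_density).
  - by move=> s; exact: exit_density_ge0.
  - exact: measurable_reborn.
  - exact: reborn_ge0.
apply: (@integral_conv_l _ _ _ pi0 (reborn_mass A n) exit_density).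
- exact: measurable_reborn_mass.
- by move=> s; exact: reborn_mass_ge0.
- exact: measurable_exit_density.
- exact: exit_density_ge0.
Qed.

(** * Laplace transform of the renewal equation *)

Variables C b : R.
Hypotheses (C_gt0 : (0 < C)%R) (b_gt0 : (0 < b)%R).
Hypothesis decay : forall t x, (0 < t)%R -> D x ->
  \int[lebesgue_rV d]_(y in D) (p t x y)%:E <= (C * expR (- b * t))%:E.

Lemma measurable_heat_slice A t : measurable A ->
  measurable_fun [set: Rd]
    (fun x => \int[lebesgue_rV d]_(y in A) heat (t, x, y)).
Proof.
move=> mA; apply: (@measurable_fun_integral_on _ _ _ _ _ _ A
    (fun q : Rd * Rd => heat (t, q.1, q.2))) => //.
  apply: (measurableT_comp measurable_heat).
  apply: measurable_fun_pair; last exact: measurable_snd.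
  by apply: measurable_fun_pair => //; exact: measurable_fst.
by move=> q; exact: heat_ge0.
Qed.

Lemma heat_mass_le (m' : probability Rd R) (A : set Rd) (t : R) :
  measurable A -> A `<=` D -> (0 < t)%R ->
  heat_mass m' A t <= (C * expR (- b * t))%:E.
Proof.
move=> mA AD t0.
have K0 : (0 <= C * expR (- b * t))%R by rewrite mulr_ge0 ?expR_ge0// ltW.
rewrite -[leRHS]mule1 -(probability_setT m') -integral_cst//.
have mh x : measurable_fun [set: Rd] (fun y => heat (t, x, y)).
  exact: (measurable_fun_pair2 (t, x) measurable_heat).
apply: ge0_le_integral => //.
- by move=> x _; apply: integral_ge0 => y _; exact: heat_ge0.
- exact: measurable_heat_slice.
- move=> x _; have [Dx|nDx] := pselect (D x); last first.
    rewrite integral0_eq ?lee_fin// => y _.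
    by rewrite heat_out// => -[].
  apply: le_trans (decay _ _ t0 Dx).
  apply: (@le_trans _ _ (\int[lebesgue_rV d]_(y in D) heat (t, x, y))).
    apply: ge0_subset_integral => //; first exact: measurable_funTS.
    by move=> y _; exact: heat_ge0.
  by rewrite (eq_integral (fun y => (p t x y)%:E))// => y /set_mem Dy; exact: heatE.
Qed.

(** The mass of [A] under the resolvent of the killed process with rate [l],
    started from [m']; at rate 0 this is the Green measure. *)
Definition green_mass (m' : probability Rd R) (A : set Rd) (l : R) : \bar R :=
  laplace l (heat_mass m' A).

Lemma green_mass_ge0 m' A l : 0 <= green_mass m' A l.
Proof. by apply: laplace_ge0 => t; exact: heat_mass_ge0. Qed.

(** The bound C exp(- b t) is C / b times the exponential density of
    parameter b. *)
Lemma green_mass_le m' A l : measurable A -> A `<=` D -> (0 <= l)%R ->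
  green_mass m' A l <= (C / b)%:E.
Proof.
move=> mA AD l0; rewrite -[leRHS]mule1 -(integral_exponential_pdf b_gt0).
have mpdf := measurable_exponential_pdf b.
have pdf0 t := @exponential_pdf_ge0 R b (ltW b_gt0) t.
have Cb : (0 <= C / b)%R by rewrite divr_ge0// ltW.
rewrite -ge0_integralZl//; last 2 first.
- exact/measurable_EFinP.
- by move=> t _; rewrite lee_fin.
apply: ge0_le_integral => //.
- by move=> t _; rewrite mule_ge0 ?heat_mass_ge0// lee_fin expR_ge0.
- apply: emeasurable_funM; first exact: measurable_expR_scale.
  exact: measurable_heat_mass.
- by apply: emeasurable_funM; [exact: measurable_cst|exact/measurable_EFinP].
- move=> t _; have [t0|t0] := leP t 0%R.
    by rewrite heat_mass_out// mule0 mule_ge0// lee_fin.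
  rewrite -EFinM exponential_pdfE ?(ltW t0)//.
  rewrite mulrA divfK ?gt_eqF//.
  apply: le_trans (heat_mass_le m' _ _ mA AD t0).
  apply: gee_pMl; rewrite ?heat_mass_ge0//.
  by rewrite lee_fin -[leRHS]expR0 ler_expR mulNr oppr_le0 mulr_ge0// ltW.
Qed.

Lemma green_mass_fin m' A l : measurable A -> A `<=` D -> (0 <= l)%R ->
  green_mass m' A l \is a fin_num.
Proof.
move=> mA AD l0; rewrite ge0_fin_numE ?green_mass_ge0//.
exact: le_lt_trans (green_mass_le m' _ _ mA AD l0) (ltry _).
Qed.

Lemma integral_expR_pos (l : R) : (0 < l)%R ->
  \int[leb]_(t in `]0%R, +oo[) (expR (- l * t))%:E = (l^-1)%:E.
Proof.
move=> l0.
have mpdf := measurable_exponential_pdf l.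
rewrite integral_itv_obnd_cbnd; last first.
  exact: (measurable_funTS (measurable_expR_scale l)).
rewrite integral_mkcond -[RHS]mule1 -(integral_exponential_pdf l0).
rewrite -ge0_integralZl//; last 3 first.
- exact/measurable_EFinP.
- by move=> t _; rewrite lee_fin exponential_pdf_ge0// ltW.
- by rewrite lee_fin invr_ge0 ltW.
apply: eq_integral => t _; rewrite patchE; case: ifPn => t0.
  rewrite exponential_pdfE; last by move: t0; rewrite inE/= in_itv/= andbT.
  by rewrite -EFinM mulrA mulVf ?gt_eqF// mul1r.
rewrite lt0_exponential_pdf ?mule0// ltNge; apply/negP => t0'.
by move: t0; rewrite mem_set//= in_itv/= t0'.
Qed.

(** Possibly +oo, since the Laplace transform of [mean_exit_density] is not
    bounded here; it multiplies the same [green_mass] for every set. *)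
Definition rebirth_weight (l : R) : \bar R :=
  \sum_(0 <= n <oo) (laplace l (mean_exit_density pi0) *
                     laplace l (mean_exit_density m) ^+ n).

Lemma laplace_reborn_mass A n l : measurable A ->
  laplace l (reborn_mass A n) =
  laplace l (mean_exit_density m) ^+ n * green_mass m A l.
Proof.
move=> mA; elim: n => [|n IH]; first by rewrite reborn_mass0// expe0 mul1e.
rewrite reborn_massS// laplace_conv.
- by rewrite IH muleA -expeS.
- exact: measurable_mean_exit_density.
- by move=> s; exact: mean_exit_density_ge0.
- exact: measurable_reborn_mass.
- by move=> s; exact: reborn_mass_ge0.
Qed.

(** [stationary_renewal] only speaks of positive times, and both sides of the
    integrated identity are supported there. *)
Lemma laplace_stationary A l : measurable A -> A `<=` D -> (0 < l)%R ->
  (l^-1)%:E * pi0 A =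
  green_mass pi0 A l + rebirth_weight l * green_mass m A l.
Proof.
move=> mA AD l0.
have e0 t : 0 <= (expR (- l * t))%:E by rewrite lee_fin expR_ge0.
have me := measurable_expR_scale l.
have c0 n t : 0 <= conv (mean_exit_density pi0) (reborn_mass A n) t.
  by apply: conv_ge0 => s; [exact: mean_exit_density_ge0|exact: reborn_mass_ge0].
have mc n : measurable_fun [set: R] (conv (mean_exit_density pi0) (reborn_mass A n)).
  apply: measurable_conv1.
  - exact: measurable_mean_exit_density.
  - by move=> s; exact: mean_exit_density_ge0.
  - exact: measurable_reborn_mass.
  - by move=> s; exact: reborn_mass_ge0.
have ms : measurable_fun [set: R] (fun t =>
    \sum_(0 <= n <oo) conv (mean_exit_density pi0) (reborn_mass A n) t).
  by apply: ge0_emeasurable_sum => // n t _ _; exact: c0.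
have s0 t : 0 <= \sum_(0 <= n <oo) conv (mean_exit_density pi0) (reborn_mass A n) t.
  by apply: nneseries_ge0 => n _ _; exact: c0.
transitivity (laplace l (fun t => heat_mass pi0 A t +
    \sum_(0 <= n <oo) conv (mean_exit_density pi0) (reborn_mass A n) t)).
  rewrite -integral_expR_pos// -ge0_integralZr//; last first.
    exact: measurable_funTS.
  rewrite integral_mkcond; apply: eq_integral => t _; rewrite patchE.
  case: ifPn => t0.
    have t0' : (0 < t)%R by move: t0; rewrite inE/= in_itv/= andbT.
    by rewrite -stationary_renewal.
  have t0' : (t <= 0)%R.
    rewrite leNgt; apply/negP => t0'.
    by move: t0; rewrite mem_set//= in_itv/= t0'.
  rewrite heat_mass_out// add0e eseries0 ?mule0// => n _ _.
  apply: conv_out => // s s0'; first exact: mean_exit_density_out.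
  by apply: integral0_eq => y _; exact: reborn_out.
rewrite /laplace.
transitivity (\int[leb]_t ((expR (- l * t))%:E * heat_mass pi0 A t +
  \sum_(0 <= n <oo) ((expR (- l * t))%:E *
     conv (mean_exit_density pi0) (reborn_mass A n) t))).
  apply: eq_integral => t _; rewrite ge0_muleDr ?heat_mass_ge0//.
  by rewrite nneseriesZl.
rewrite ge0_integralD//; last 4 first.
- by move=> t _; rewrite mule_ge0 ?heat_mass_ge0.
- by apply: emeasurable_funM => //; exact: measurable_heat_mass.
- by move=> t _; apply: nneseries_ge0 => n _ _; rewrite mule_ge0.
- apply: ge0_emeasurable_sum => [n t _ _|n _]; first by rewrite mule_ge0.
  by apply: emeasurable_funM; [exact: me|exact: mc].
congr (_ + _); rewrite integral_nneseries//; last 2 first.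
- by move=> n; apply: emeasurable_funM; [exact: me|exact: mc].
- by move=> n t _; rewrite mule_ge0.
rewrite -nneseries_mulr; last 2 first.
- move=> n; rewrite mule_ge0 ?expe_ge0 ?laplace_ge0// => s;
    exact: mean_exit_density_ge0.
- exact: green_mass_ge0.
apply: eq_eseriesr => n _.
rewrite -muleA -laplace_reborn_mass// -laplace_conv//.
- exact: measurable_mean_exit_density.
- by move=> s; exact: mean_exit_density_ge0.
- exact: measurable_reborn_mass.
- by move=> s; exact: reborn_mass_ge0.
Qed.

(** * The limit of vanishing rate *)

Lemma heat_mass_le_dom (A : set Rd) t : measurable A -> A `<=` D ->
  heat_mass m A t <= heat_mass m D t.
Proof.
move=> mA AD; apply: ge0_le_integral => //.
- by move=> x _; apply: integral_ge0 => y _; exact: heat_ge0.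
- exact: measurable_heat_slice.
- exact: measurable_heat_slice.
- move=> x _; apply: ge0_subset_integral => //.
    apply: measurable_funTS.
    exact: (measurable_fun_pair2 (t, x) measurable_heat).
  by move=> y _; exact: heat_ge0.
Qed.

(** Comparing [laplace_stationary] for [A] and for [D] eliminates the weight.
    If the weight is infinite, both resolvent masses of m vanish, and so do
    the two sides. *)
Lemma stationary_green_mass_real A l : measurable A -> A `<=` D -> (0 < l)%R ->
  (fine (green_mass m A l) * (1 - l * fine (green_mass pi0 D l)) =
   (fine (pi0 A) - l * fine (green_mass pi0 A l)) * fine (green_mass m D l))%R.
Proof.
move=> mA AD l0.
have gfin m' B : measurable B -> B `<=` D ->
    exists2 r : R, green_mass m' B l = r%:E & (0 <= r)%R.
  move=> mB BD; exists (fine (green_mass m' B l)).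
    by rewrite fineK// green_mass_fin// ltW.
  by rewrite fine_ge0// green_mass_ge0.
have [a aE a0] := gfin m A mA AD.
have [e eE e0] := gfin m D mD (@subset_refl _ D).
have [a' a'E _] := gfin pi0 A mA AD.
have [e' e'E _] := gfin pi0 D mD (@subset_refl _ D).
have [q qE] : exists q : R, pi0 A = q%:E.
  by exists (fine (pi0 A)); rewrite fineK// fin_num_measure.
have ae : (a <= e)%R.
  rewrite -lee_fin -aE -eE; apply: laplace_le.
  - exact: measurable_heat_mass.
  - exact: measurable_heat_mass.
  - by move=> t; exact: heat_mass_ge0.
  - by move=> t; exact: heat_mass_le_dom.
have := laplace_stationary A l mA AD l0.
have := laplace_stationary D l mD (@subset_refl _ D) l0.
have [piD _] := hpi0.
rewrite piD mule1 aE eE a'E e'E qE /=.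
have : 0 <= rebirth_weight l.
  apply: nneseries_ge0 => n _ _.
  by rewrite mule_ge0 ?expe_ge0 ?laplace_ge0// => s; exact: mean_exit_density_ge0.
case: (rebirth_weight l) => [r| |//] _.
- rewrite -!EFinM -!EFinD => -[ED] [EA].
  have l1 : (l * l^-1 = 1)%R by rewrite mulfV ?gt_eqF.
  have -> : (q = l * (l^-1 * q))%R by rewrite mulrA l1 mul1r.
  rewrite EA.
  have -> : (1 - l * e' = l * (r * e))%R by rewrite -l1 ED; ring.
  by ring.
- move=> ED _; have ee : e = 0%R.
    apply/eqP; rewrite eq_le e0 andbT leNgt; apply/negP => ep.
    by move: ED; rewrite gt0_mulye// addey.
  have -> : a = 0%R by apply/eqP; rewrite eq_le a0 andbT -ee.
  by rewrite ee mul0r mulr0.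
Qed.

Let eps (n : nat) : R := (n.+1%:R^-1)%R.

(** Monotone convergence, as exp(- eps n t) increases to 1. *)
Lemma cvg_green_mass m' A : measurable A -> A `<=` D ->
  green_mass m' A (eps n) @[n --> \oo] --> green_mass m' A 0.
Proof.
move=> mA AD.
have mh := measurable_heat_mass m' A mA.
have hfin t : heat_mass m' A t \is a fin_num.
  have [t0|t0] := leP t 0%R; first by rewrite heat_mass_out.
  rewrite ge0_fin_numE ?heat_mass_ge0//.
  exact: le_lt_trans (heat_mass_le m' A t mA AD t0) (ltry _).
have cv t : ((expR (- eps n * t))%:E * heat_mass m' A t) @[n --> \oo] -->
    (expR (- 0 * t))%:E * heat_mass m' A t.
  rewrite -(fineK (hfin t)); apply: cvg_EFin; first exact: nearW.
  apply: cvgMl; apply: continuous_cvg; first exact: continuous_expR.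
  by apply: cvgMl; apply: cvgN; exact: cvg_harmonic.
rewrite /green_mass /laplace.
have -> : \int[leb]_t ((expR (- 0 * t))%:E * heat_mass m' A t) =
    \int[leb]_t limn (fun n => (expR (- eps n * t))%:E * heat_mass m' A t).
  by apply: eq_integral => t _; apply/esym/cvg_lim => //; exact: cv.
apply: cvg_monotone_convergence => //.
- move=> n; apply: emeasurable_funM; first exact: measurable_expR_scale.
  exact: mh.
- by move=> n t _; rewrite mule_ge0 ?heat_mass_ge0// lee_fin expR_ge0.
- move=> t _ n k nk; have [t0|t0] := leP t 0%R.
    by rewrite !heat_mass_out// !mule0.
  rewrite lee_wpmul2r ?heat_mass_ge0// lee_fin ler_expR ler_pM2r// lerN2.
  by rewrite lef_pV2 ?posrE// ler_nat.
Qed.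

Lemma integral_reborn0 y : D y ->
  \int[leb]_t reborn 0 (t, y) = \int[m]_(x in D) green p x y.
Proof.
move=> Dy /=.
have mh : measurable_fun [set: R * Rd] (fun q => heat (q.1, q.2, y)).
  apply: (measurableT_comp measurable_heat).
  apply: measurable_fun_pair; last exact: measurable_cst.
  exact: measurable_fun_pair.
apply: etrans (tonelli_on leb m setT _ measurableT mh _) _.
  by move=> q; exact: heat_ge0.
rewrite [RHS]integral_mkcond; apply: eq_integral => x _ /=.
rewrite patchE; case: ifPn => [/set_mem Dx|/negP nDx].
  rewrite /green [RHS]integral_mkcond; apply: eq_integral => s _.
  rewrite patchE; case: ifPn => [|/negP].
    by rewrite inE/= in_itv/= andbT => s0; rewrite heatE.
  by rewrite inE/= in_itv/= andbT => s0; rewrite heat_out// => -[].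
by apply: integral0_eq => s _; rewrite heat_out// => -[_ Dx _];
  apply: nDx; rewrite inE.
Qed.

Lemma measurable_mean_green :
  measurable_fun D (fun y => \int[m]_(x in D) green p x y).
Proof.
apply: (eq_measurable_fun (fun y => \int[leb]_t reborn 0 (t, y))).
  by move=> y /set_mem Dy; exact: integral_reborn0.
apply: measurable_funTS.
apply: (@measurable_fun_integral_on _ _ _ _ _ leb setT
  (fun q : Rd * R => reborn 0 (q.2, q.1))) => //.
  apply: (measurableT_comp (measurable_reborn 0)).
  by apply: measurable_fun_pair; [exact: measurable_snd|exact: measurable_fst].
by move=> q; exact: reborn_ge0.
Qed.

Lemma green_massE A : measurable A -> A `<=` D ->
  green_mass m A 0 = \int[lebesgue_rV d]_(y in A) \int[m]_(x in D) green p x y.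
Proof.
move=> mA AD.
transitivity (\int[leb]_t reborn_mass A 0 t).
  apply: eq_integral => t _.
  by rewrite oppr0 mul0r expR0 mul1e reborn_mass0.
apply: etrans (tonelli_on leb (lebesgue_rV d) A (reborn 0) mA
  (measurable_reborn 0) (reborn_ge0 0)) _.
by apply: eq_integral => y /set_mem/AD; exact: integral_reborn0.
Qed.

Lemma stationary_green_mass A : measurable A -> A `<=` D ->
  green_mass m A 0 = pi0 A * green_mass m D 0.
Proof.
move=> mA AD.
have lim B m' : measurable B -> B `<=` D ->
    fine (green_mass m' B (eps n)) @[n --> \oo] --> fine (green_mass m' B 0).
  move=> mB BD; apply: fine_cvg; rewrite fineK ?green_mass_fin//.
  exact: cvg_green_mass.
have lim0 B : measurable B -> B `<=` D ->
    (eps n * fine (green_mass pi0 B (eps n)))%R @[n --> \oo] --> 0%R.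
  move=> mB BD; rewrite -(mul0r (fine (green_mass pi0 B 0))).
  by apply: cvgM; [exact: cvg_harmonic|exact: lim].
have DD := @subset_refl _ D.
have E : (fine (green_mass m A 0) = fine (pi0 A) * fine (green_mass m D 0))%R.
  apply: (balance_limit _ _ _ _ _ _ _ _ _ (lim A m mA AD) (lim D m mD DD)
    (lim0 A mA AD) (lim0 D mD DD)) => n.
  by apply: stationary_green_mass_real => //; rewrite invr_gt0.
rewrite -[LHS]fineK ?green_mass_fin// E EFinM.
by rewrite !fineK ?green_mass_fin ?fin_num_measure.
Qed.

(** If the Green measure of m were zero, [laplace_stationary] would read
    1 / l = green_mass pi0 D l, which exceeds the bound C / b for small l. *)
Lemma green_mass_gt0 : 0 < green_mass m D 0.
Proof.
rewrite lt_neqAle green_mass_ge0 andbT eq_sym; apply/negP => /eqP g0.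
pose l := (b / (2 * C))%R.
have l0 : (0 < l)%R by rewrite divr_gt0// mulr_gt0.
have DD := @subset_refl _ D.
have gl0 : green_mass m D l = 0.
  apply/eqP; rewrite eq_le green_mass_ge0 andbT -g0.
  apply: laplace_le_rate; first exact: ltW.
  - exact: measurable_heat_mass.
  - by move=> t; exact: heat_mass_ge0.
  - by move=> t; exact: heat_mass_out.
have [piD _] := hpi0.
have := laplace_stationary D l mD DD l0.
rewrite piD mule1 gl0 mule0 adde0 => E.
have := green_mass_le pi0 D l mD DD (ltW l0).
rewrite -E lee_fin invf_div -mulrA -[leRHS]mul1r ler_pM2r ?divr_gt0//.
by lra.
Qed.

End kernel.
End renewal.

(** * The stationary density *)

Theorem theorem5p3 (R : realType) (d : nat) (hd : (0 < d)%N)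
  (alpha : R) (halpha : 0 < alpha < 2)
  (D : set 'rV[R]_d) (hD0 : D !=set0) (hDb : bounded_set D)
  (hDL : lipschitz_set D)
  (disp : measure_display) (Omega : measurableType disp)
  (P : probability Omega R) (Y : R -> Omega -> 'rV[R]_d)
  (hY : stable_process P alpha Y)
  (p : R -> 'rV[R]_d -> 'rV[R]_d -> R) (hp : dirichlet_heat_kernel P Y D p)
  (mu : 'rV[R]_d -> probability 'rV[R]_d R) (hmu : reflection_kernel D mu)
  (pi0 : probability 'rV[R]_d R) (hpi0 : stationary D mu alpha p pi0)
  (kappa : 'rV[R]_d -> R) (hkappa : density D kappa pi0)
  (m : probability 'rV[R]_d R) (hm : m D = 1%E)
  (hmum : forall w (A : set 'rV[R]_d), ~ D w -> measurable A -> mu w A = m A) :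
  let mg : 'rV[R]_d -> \bar R := fun y => (\int[m]_(x in D) green p x y)%E in
  exists c : R,
    [/\ 0 < c,
        (\int[lebesgue_rV d]_(y in D) (c%:E * mg y) = 1)%E &
        {ae lebesgue_rV d, forall y, D y -> (kappa y)%:E = (c%:E * mg y)%E}].
Proof.
move=> mg.
have a0 : 0 < alpha by case/andP: halpha.
have oD : open D by case: hDL.
have mD := open_measurable_rV R d D oD.
have [p0 pc _] := hp.
have [C [b [C0 b0 decay]]] := survival_le_expR alpha Y hY D p hp mD hDb hd.
have [piD _] := hpi0; have [mk k0 kE] := hkappa.
have DD := @subset_refl _ D.
pose G A := green_mass D p m A 0.
have GE A : measurable A -> A `<=` D -> G A = (\int[lebesgue_rV d]_(y in A) mg y)%E.
  exact: (green_massE alpha D p a0 oD p0 pc m).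
have stG A : measurable A -> A `<=` D -> G A = (pi0 A * G D)%E.
  exact: (stationary_green_mass alpha D p a0 oD p0 pc m hm mu hmu hmum pi0 hpi0
    C b C0 b0 decay).
have GD0 : (0 < G D)%E.
  exact: (green_mass_gt0 alpha D p a0 oD p0 pc m hm mu hmu hmum pi0 hpi0
    C b C0 b0 decay).
have GDfin : G D \is a fin_num.
  exact: (green_mass_fin D p oD p0 pc C b C0 b0 decay).
have mg0 y : D y -> (0 <= mg y)%E.
  move=> Dy; apply: integral_ge0 => x Dx; apply: integral_ge0 => s.
  by rewrite /= in_itv/= andbT => s0; rewrite lee_fin p0.
have mmg : measurable_fun D mg.
  exact: (measurable_mean_green alpha D p a0 oD p0 pc m).
pose c := (fine (G D))^-1.
have c0 : 0 < c by rewrite invr_gt0 fine_gt0// GD0 ltey_eq GDfin.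
have cG : (c%:E * G D = 1)%E.
  by rewrite -(fineK GDfin) -EFinM mulVf// gt_eqF// -invr_gt0.
have cmgE A : measurable A -> A `<=` D ->
    (\int[lebesgue_rV d]_(y in A) (c%:E * mg y) = pi0 A)%E.
  move=> mA AD; rewrite ge0_integralZl//.
  - by rewrite -GE// stG// muleCA cG mule1.
  - exact: measurable_funS mmg.
  - by move=> y Ay; apply/mg0/AD.
  - by rewrite lee_fin ltW.
exists c; split => //; first by rewrite cmgE.
apply: (integral_ae_eq mD).
- apply/integrableP; split; first exact/measurable_EFinP.
  rewrite (eq_integral (fun y => (kappa y)%:E)); last first.
    by move=> y /set_mem Dy; rewrite gee0_abs// lee_fin k0.
  by rewrite -kE// piD ltry.
- exact: emeasurable_funM.
- by move=> A AD mA; rewrite cmgE// -kE.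
Qed.
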